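(* Let $(G,\mu)$ be an admissible pair with $G$ transient, let $\mathcal S=\operatorname{supp}\mu$ and $\varepsilon_0=\min_{s\in\mathcal S}\mu(s)$. Then $G$ is hyperbolic if and only if there exists $\varepsilon\in(0,\varepsilon_0)$ such that, for every sufficiently long geodesic word $\gamma\in\langle\mathcal S\rangle$ (i.e. for all geodesic words $\gamma$ with $\ell_\gamma\geqslant L_0$, for some $L_0$), with $g=\boldsymbol\pi(\gamma)$, $$\mathbb P_{\boldsymbol\iota,g}\{\psi\in\boldsymbol\pi^{-1}(g):\ \text{the path } \psi \text{ starting at } \boldsymbol\iota \text{ visits no vertex of } B(I_\gamma)\}\leqslant\varepsilon^{5\ell_\gamma}.$$ (Equivalently, the bound is $\varepsilon^{10r}$, where $r=\ell_\gamma/2$ is the radius of the ball $B(I_\gamma)$.)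
   Context: An admissible pair $(G,\mu)$ is a group $G$ with a probability measure $\mu$ on $G$ that is symmetric ($\mu(g)=\mu(g^{-1})$), has finite support $\mathcal S=\operatorname{supp}\mu=\{g:\mu(g)>0\}$, and such that $\mathcal S$ generates $G$. Denote by $\boldsymbol\iota$ the neutral element of $G$. Let $\langle\mathcal S\rangle$ be the free monoid on $\mathcal S$ (words, including the empty word), $\ell_\psi$ the length of a word $\psi$, and $\boldsymbol\pi:\langle\mathcal S\rangle\to G$ the evaluation homomorphism. A word $\gamma$ is geodesic if $\ell_\gamma=|\boldsymbol\pi(\gamma)|$, where $|g|=\min\{\ell_\psi:\boldsymbol\pi(\psi)=g\}$. A word $\psi=s_1\dots s_n$ is regarded as the path from $\boldsymbol\iota$ in the Cayley graph $\mathrm{Ca}(G,\mathcal S)$ visiting the vertices $\boldsymbol\pi(s_1\cdots s_i)$, $0\leqslant i\leqslant n$. For a geodesic word $\gamma$, $I_\gamma$ is the geodesic segment traced by $\gamma$ from $\boldsymbol\iota$ to $\boldsymbol\pi(\gamma)$ in the Cayley graph (a metric graph with edges of length $1$), and $B(I_\gamma)$ is the open ball of radius $\ell_\gamma/2$ centered at the midpoint of $I_\gamma$. The weight of a word $\psi=s_1\dots s_n$ is $\mu_\psi=\prod_{i=1}^n\mu(s_i)$ (and $1$ for the empty word). The Green function is $\mathrm{Gr}_\mu(g)=\sum\{\mu_\psi:\psi\in\boldsymbol\pi^{-1}(g)\}$. $G$ is transient (with respect to $\mu$) if $\mathrm{Gr}_\mu(g)<\infty$ for some, equivalently every, $g\in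 G$. For transient $G$, $\mathbb P_{\boldsymbol\iota,g}$ is the probability measure on the set $\boldsymbol\pi^{-1}(g)$ with $\mathbb P_{\boldsymbol\iota,g}\{\psi\}=\mu_\psi/\mathrm{Gr}_\mu(g)$. *)

(* Defs.v *)
(* Groups are possibly infinite ([groupType]); subsets of a group are classical
   sets; a word is a sequence of group elements. *)
From HB Require Import structures.
From mathcomp Require Import all_boot all_order all_algebra.
From mathcomp Require Import all_classical all_reals all_analysis.

Set Implicit Arguments.
Unset Strict Implicit.
Unset Printing Implicit Defensive.

Import Order.TTheory GRing.Theory Num.Theory.

Local Open Scope classical_set_scope.
Local Open Scope ring_scope.

Definition generates (G : groupType) (A : set G) : Prop :=
  forall H : {pred G}, group_closed H -> (forall s, A s -> s \in H) ->
    forall g, g \in H.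

Definition symmetric_set (G : groupType) (A : set G) : Prop :=
  forall s, A s -> A (s^-1)%g.

Definition is_word (G : groupType) (A : set G) (w : seq G) : Prop :=
  forall s, s \in w -> A s.

Definition word_eval (G : groupType) (w : seq G) : G := (\prod_(s <- w) s)%g.

Definition words_to (G : groupType) (A : set G) (g : G) : set (seq G) :=
  [set w | is_word A w /\ word_eval w = g].

(* The default value 0 is only used when no word over A evaluates to g; this
   does not happen if A is symmetric and generates G. *)
Definition word_length (G : groupType) (A : set G) (g : G) : nat :=
  xget 0%N [set n | (exists2 w, words_to A g w & size w = n) /\
                    (forall w, words_to A g w -> (n <= size w)%N)].

(* Distance in the Cayley graph with edges [x, x * s], s in A. *)
Definition word_dist (G : groupType) (A : set G) (x y : G) : nat :=
  word_length A (x^-1 * y)%g.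

Definition geodesic (G : groupType) (A : set G) (w : seq G) : Prop :=
  is_word A w /\ size w = word_length A (word_eval w).

Definition gromov_product (T : Type) (d : T -> T -> nat) (o x y : T) : rat :=
  ((d o x)%:R + (d o y)%:R - (d x y)%:R) / 2.

Definition gromov_hyperbolic (T : Type) (d : T -> T -> nat) : Prop :=
  exists delta : rat, forall o x y z : T,
    Num.min (gromov_product d o x y) (gromov_product d o y z) - delta
      <= gromov_product d o x z.

(* An intrinsic property of G, not tied to the support of a measure.
   Restricting to symmetric A is harmless: A and its union with the inverses of
   its elements have the same (undirected) Cayley graph. *)
Definition hyperbolic_group (G : groupType) : Prop :=
  exists A : set G,
    [/\ finite_set A, symmetric_set A, generates A
      & gromov_hyperbolic (word_dist A)].

(* Distance in the metric Cayley graph from the vertex v to the point of the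
   edge [x, y] lying at distance t from x, where 0 <= t <= 1. *)
Definition dist_to_edge_point (R : realType) (G : groupType) (A : set G)
    (v x y : G) (t : R) : R :=
  Num.min ((word_dist A v x)%:R + t) ((word_dist A v y)%:R + (1 - t)).

(* The midpoint of the segment traced by w is the vertex reached after
   (size w)./2 letters if size w is even, and the midpoint of the next edge if
   size w is odd. *)
Definition dist_to_midpoint (R : realType) (G : groupType) (A : set G)
    (w : seq G) (v : G) : R :=
  dist_to_edge_point A v (word_eval (take (size w)./2 w))
    (word_eval (take (size w)./2.+1 w)) ((odd (size w))%:R / 2).

Definition ball_vertices (R : realType) (G : groupType) (A : set G)
    (w : seq G) : set G :=
  [set v | dist_to_midpoint R A w v < (size w)%:R / 2].

Definition path_avoids (G : groupType) (B : set G) : set (seq G) :=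
  [set psi | forall i, (i <= size psi)%N -> ~ B (word_eval (take i psi))].

Definition supp (R : realType) (G : groupType) (mu : G -> R) : set G :=
  [set g | 0 < mu g].

(* The last sum is a genuine finite sum, as the support is finite. *)
Definition admissible (R : realType) (G : groupType) (mu : G -> R) : Prop :=
  [/\ forall g, 0 <= mu g,
      forall g, mu g = mu (g^-1)%g,
      finite_set (supp mu),
      generates (supp mu)
    & \sum_(g \in supp mu) mu g = 1].

(* The minimum of mu on its support, which is finite and nonempty. *)
Definition min_weight (R : realType) (G : groupType) (mu : G -> R) : R :=
  inf [set mu s | s in supp mu].

Definition weight (R : realType) (G : groupType) (mu : G -> R) (w : seq G) : R :=
  \prod_(s <- w) mu s.

Definition green (R : realType) (G : groupType) (mu : G -> R) (g : G) : \bar R :=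
  (\esum_(psi in words_to (supp mu) g) (weight mu psi)%:E)%E.

Definition transient (R : realType) (G : groupType) (mu : G -> R) : Prop :=
  exists g, (green mu g < +oo)%E.

(* The probability P_{1,g}(E) that a random path from 1 to g belongs to E; it is
   meant for transient mu, where the Green function is finite and positive. *)
Definition bridge_prob (R : realType) (G : groupType) (mu : G -> R) (g : G)
    (E : set (seq G)) : \bar R :=
  (\esum_(psi in words_to (supp mu) g `&` E)
     (weight mu psi / fine (green mu g))%:E)%E.

(* Main.v *)
(** Suppose that [G] is hyperbolic. A path that avoids the ball on a geodesic
    segment of length [l] is longer than any given multiple of [l], for large
    [l]; so it is enough that the return probabilities decay exponentially.
    Spheres are unbounded, because linear growth would make the walk recurrent.
    Large spheres in a hyperbolic group contain long tripods with small Gromov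
    products; at each vertex at least two of the three legs of a translated
    tripod lead away from the origin. Following such legs for [k] generations,
    every vertex has exponentially many descendants in [k], but only linearly
    many ancestors, since those are close to a geodesic to the origin. This
    gives [<f, f> <= C <f, (1 - P) f>] for the Markov operator [P], whence the
    decay.

    Conversely, a path of length [n] has weight at least [e0 ^+ n], where [e0]
    is the minimal weight, and the Green function is bounded. So the hypothesis
    with [eps < e0] forces each detour around the ball on a long geodesic
    segment of length [2 r] to have length at least [(10 + 1 / q) r], for some
    fixed [q]. If a point [p] of a geodesic
    has (almost) maximal distance [D] to another path with the same endpoints
    which is geodesic up to a bounded error, then the detour that leaves the
    geodesic at distance [2 D] on either side of [p] and follows the other path
    in between has length about [10 D]. So geodesics from a common origin to
    points at distance [K] are close, up to a constant independent of [K],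
    except near their ends. Bisecting paths, one gets exponential divergence of
    geodesics, and this bounds the corners of geodesic triangles. *)

Require Import Defs.
From HB Require Import structures.
From mathcomp Require Import all_boot all_order all_algebra.
From mathcomp Require Import all_classical all_reals all_analysis.
From mathcomp Require Import zify ring lra.

Set Implicit Arguments.
Unset Strict Implicit.
Unset Printing Implicit Defensive.

Import Order.TTheory GRing.Theory Num.Theory.

(** * Connecting paths and geodesics *)

Lemma arg_max_nat (F : nat -> nat) n :
  exists2 p, p <= n & forall t, t <= n -> F t <= F p.
Proof.
elim: n => [|n [p lepn maxp]]; first by exists 0 => // t; rewrite leqn0 => /eqP ->.
case: (leqP (F n.+1) (F p)) => lt_F.
  exists p => [|t]; first by lia.
  by rewrite leq_eqVlt ltnS => /orP[/eqP -> //|/maxp].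
exists n.+1 => // t; rewrite leq_eqVlt ltnS => /orP[/eqP -> //|/maxp]; lia.
Qed.

Lemma linear_le_expn a b : exists J, forall j, J <= j -> a * j + b <= 2 ^ j.
Proof.
have sq m : m * m <= 4 * 2 ^ m.
  elim: m => [//|m IHm]; case: (leqP m 2) => [|lt2m].
    by case: m {IHm} => [|[|[|]]].
  by rewrite expnS; nia.
exists (4 * (a + b) + 1) => j lej.
have := sq j; nia.
Qed.

(** This takes the place of logarithms. The witness [k] is about [l / (a + 1)], so that [a * k + b]
    fits below [l] while [2 ^ k] outgrows any linear function of [l]. *)
Lemma linear_log a b c e : exists L, forall l, L <= l ->
  exists k, c * l + e <= 2 ^ k /\ a * k + b <= l.
Proof.
have [J leJ] := linear_le_expn (c * a.+1) (c * a.+1 + c * b + c + e).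
exists (a.+1 * J + b) => l lel; exists ((l - b) %/ a.+1); set k := _ %/ _.
have kl : k * a.+1 <= l - b := leq_divM _ _.
have kg : l - b < k.+1 * a.+1 := ltn_ceil _ (ltn0Sn a).
have leJk : J <= k by rewrite -ltnS -(ltn_pmul2r (ltn0Sn a)); apply: leq_ltn_trans kg; lia.
split; last by lia.
have := leJ k leJk; apply: leq_trans.
have : c * l <= c * (k.+1 * a.+1 + b) by rewrite leq_mul2l; apply/orP; right; lia.
lia.
Qed.

Section Connected.
Variables (T : Type) (e : T -> T -> Prop).
Implicit Types (P : T -> Prop) (x y z : T).

(** Since [conn_refl] holds for every index, [n] is only an upper bound for the number of steps.
    Both endpoints satisfy [P]. *)
Inductive conn P : nat -> T -> T -> Prop :=
| conn_refl n x : P x -> conn P n x x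
| conn_step n x y z : P x -> e x y -> conn P n y z -> conn P n.+1 x z.

Lemma conn_le P n m x y : n <= m -> conn P n x y -> conn P m x y.
Proof.
move=> lenm cn; elim: cn m lenm => {n x y} [n x Px m _|n x y z Px exy _ IH [//|m] lenm].
  exact: conn_refl.
exact: conn_step Px exy (IH _ _).
Qed.

Lemma conn_trans P n m x y z : conn P n x y -> conn P m y z -> conn P (n + m) x z.
Proof.
move=> cn; elim: cn => {n x y} [n x _|n x y w Px exy _ IH /IH].
  by apply: conn_le; rewrite leq_addl.
exact: conn_step.
Qed.

Lemma conn_endl P n x y : conn P n x y -> P x.
Proof. by case. Qed.

Lemma conn_endr P n x y : conn P n x y -> P y.
Proof. by elim. Qed.

Lemma conn1 P x y : (forall v, e v v) -> conn P 1 x y -> e x y.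
Proof.
move=> refl_e; move E: 1 => k cxy; case: cxy E => [m v|m u v w _ euv cvw [m0]] //.
rewrite -{}m0 in cvw; move E: 0 cvw => k' cvw.
by case: cvw E euv => [m' z|].
Qed.

Lemma conn_split P m n x z : conn P (m + n) x z ->
  exists y, [/\ P y, conn P m x y & conn P n y z].
Proof.
elim: m x => [|m IHm] x cxz.
  by exists x; split=> //; [|apply: conn_refl]; apply: conn_endl cxz.
have: conn P (m.+1 + n) x z by [].
move E: (m.+1 + n) => k ck; case: ck E IHm => {k x z cxz} [k x Px _ _|k x y z Px exy cyz].
  by exists x; split=> //; apply: conn_refl.
move=> [E] IHm; rewrite -{}E in cyz; have [w [Pw cyw cwz]] := IHm _ cyz.
by exists w; split=> //; apply: conn_step cyw.
Qed.

Lemma conn_sym P n x y : (forall a b, e a b -> e b a) ->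
  conn P n x y -> conn P n y x.
Proof.
move=> sym_e; elim=> {n x y} [n x Px|n x y z Px exy cyz IH]; first exact: conn_refl.
rewrite -addn1; apply: conn_trans IH _.
apply: conn_step (conn_endl cyz) (sym_e _ _ exy) _; exact: conn_refl.
Qed.

Lemma conn_mono P Q n x y : (forall v, P v -> Q v) -> conn P n x y -> conn Q n x y.
Proof.
move=> sPQ; elim=> {n x y} [n x /sPQ|n x y z /sPQ Qx exy _]; first exact: conn_refl.
exact: conn_step.
Qed.

Lemma conn_fun P (c : nat -> T) i j : i <= j ->
  (forall k, i <= k -> k < j -> e (c k) (c k.+1)) ->
  (forall k, i <= k -> k <= j -> P (c k)) -> conn P (j - i) (c i) (c j).
Proof.
move=> leij; have {leij} [k ->] : exists k, j = i + k by exists (j - i); lia.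
elim: k i => [|k IHk] i ec Pc; first by rewrite addn0; apply: conn_refl; apply: Pc; lia.
have -> : i + k.+1 - i = (i.+1 + k - i.+1).+1 by lia.
apply: (@conn_step _ _ _ (c i.+1)); [apply: Pc; lia|apply: ec; lia|].
have -> : i + k.+1 = i.+1 + k by lia.
by apply: IHk => [l ? ?|l ? ?]; [apply: ec|apply: Pc]; lia.
Qed.

End Connected.

Lemma conn_rel (T : Type) (e e' : T -> T -> Prop) P n x y :
  (forall a b, e a b -> e' a b) -> conn e P n x y -> conn e' P n x y.
Proof.
move=> see'; elim=> {n x y} [n x Px|n x y z Px /see' exy _]; first exact: conn_refl.
exact: conn_step.
Qed.

(** Gromov's four-point condition with doubled products at [o], so that no halves occur; [D] stands
    for [2 * delta]. *)
Definition hyp4 (T : Type) (d : T -> T -> nat) D := forall o x y z,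
  d x z + d o y <= maxn (d o z + d x y) (d o x + d y z) + D.

(** * Integer-valued geodesic metrics *)

Section Metric.
Variables (T : Type) (d : T -> T -> nat).

Definition is_metric :=
  [/\ forall x, d x x = 0, forall x y, d x y = d y x
    & forall x y z, d x z <= d x y + d y z].

Definition geod (c : nat -> T) n :=
  forall i j, i <= j -> j <= n -> d (c i) (c j) = j - i.

Definition geodesic_space :=
  forall x y, exists c, [/\ geod c (d x y), c 0 = x & c (d x y) = y].

Definition adj x y := d x y <= 1.

(** The inequality says [n >= (10 + 1 / q) * r]. The paths constructed below have length about
    [10 * r]; the surplus [1 / q] excludes them. *)
Definition detour q r0 := forall r c n, r0 <= r -> geod c (2 * r) ->
  conn adj (fun v => r <= d (c r) v) n (c 0) (c (2 * r)) ->
  (10 * q + 1) * r <= q * n.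

Hypotheses (dM : is_metric) (dG : geodesic_space).
Let d0 x : d x x = 0. Proof. by case: dM. Qed.
Let dC x y : d x y = d y x. Proof. by case: dM. Qed.
Let dT x y z : d x z <= d x y + d y z. Proof. by case: dM. Qed.

Lemma geod_adj c n k : geod c n -> k < n -> adj (c k) (c k.+1).
Proof. by move=> gc ltkn; rewrite /adj gc // subSnn. Qed.

Lemma adj_sym x y : adj x y -> adj y x.
Proof. by rewrite /adj dC. Qed.

Lemma geod_rev c n : geod c n -> geod (fun t => c (n - t)) n.
Proof. by move=> gc i j leij lejn; rewrite dC gc; lia. Qed.

Lemma geod_shift c n k m : geod c n -> k + m <= n -> geod (fun t => c (k + t)) m.
Proof. by move=> gc lekm i j leij lejm; rewrite gc; lia. Qed.

Lemma geod_trunc c n m : geod c n -> m <= n -> geod c m.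
Proof. by move=> gc lemn i j leij lejm; rewrite gc; lia. Qed.

Lemma geod_conn P c n i j : geod c n -> i <= j -> j <= n ->
  (forall k, i <= k -> k <= j -> P (c k)) -> conn adj P (j - i) (c i) (c j).
Proof.
move=> gc leij lejn Pc; apply: conn_fun => // k leik ltkj.
by apply: (geod_adj gc); lia.
Qed.

Lemma dist_conn (P : T -> Prop) x y :
  (forall v, d x v + d v y = d x y -> P v) -> conn adj P (d x y) x y.
Proof.
have [c [gc c0 cn]] := dG x y => Pv.
rewrite -{2}c0 -{2}cn -{1}[d x y]subn0; apply: (geod_conn gc) => // k _ lek.
by apply: Pv; rewrite -{1}c0 -{1}cn !gc //; lia.
Qed.

(** * Contraction of geodesics with a common origin *)

Section Detour.
Variables (q r0 : nat).
Hypotheses (q_gt0 : 0 < q) (dD : detour q r0).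

(* The detour leaves the geodesic at c (p - D), returns to c u, jumps to the
   path b and comes back symmetrically. *)
Lemma detour_path c n b nb p u v su sv D M :
  geod c n -> (forall k, k < nb -> adj (b k) (b k.+1)) ->
  r0 <= D -> u + D <= p -> p + D <= v -> v <= n -> su <= nb -> sv <= nb ->
  (forall k, k <= nb -> D <= d (c p) (b k)) ->
  d (c u) (b su) = 0 \/ D + d (c u) (b su) <= p - u ->
  d (c v) (b sv) = 0 \/ D + d (c v) (b sv) <= v - p ->
  (su - sv) + (sv - su) <= M ->
  (10 * q + 1) * D <=
    q * ((v - u) - 2 * D + d (c u) (b su) + d (c v) (b sv) + M).
Proof.
move=> gc adjb leD leu lev levn lesu lesv farb Hu Hv leM.
pose P w := D <= d (c p) w.
have farc k : k <= n -> k + D <= p \/ p + D <= k -> P (c k).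
  move=> lekn [] lek; rewrite /P; first by rewrite dC gc; lia.
  by rewrite gc; lia.
(* A point of a geodesic from [c w] to [b s] is within [d (c w) (b s)] of [c w], which is at least
   [D] further than that from [c p]. For length 0 the distance from [c p] to [b s] suffices. *)
have jump w s : w <= n -> s <= nb -> d (c p) (c w) >= D ->
    d (c w) (b s) = 0 \/ D + d (c w) (b s) <= d (c p) (c w) ->
    conn adj P (d (c w) (b s)) (c w) (b s).
  move=> lewn les farw Hw; apply: dist_conn => z Hz; rewrite /P.
  have := farb _ les; have := dT (c p) z (c w); have := dT (c p) z (b s).
  rewrite (dC z (c w)); lia.
have duE : d (c p) (c u) = p - u by rewrite dC gc; lia.
have dvE : d (c p) (c v) = v - p by rewrite gc; lia.
have cb : conn adj P M (b su) (b sv).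
  apply: (@conn_le _ _ _ ((su - sv) + (sv - su))) => //.
  case: (leqP su sv) => [le|lt].
    have -> : su - sv + (sv - su) = sv - su by lia.
    by apply: conn_fun => // k ? ?; [apply: adjb|apply: farb]; lia.
  have -> : su - sv + (sv - su) = su - sv by lia.
  apply: conn_sym; first exact: adj_sym.
  by apply: conn_fun => [|k ? ?|k ? ?]; [lia|apply: adjb; lia|apply: farb; lia].
have c1 : conn adj P ((p - D) - u) (c u) (c (p - D)).
  by apply: (geod_conn gc) => [||k ? ?]; [lia|lia|apply: farc; lia].
have c2 : conn adj P (v - (p + D)) (c (p + D)) (c v).
  by apply: (geod_conn gc) => [||k ? ?]; [lia|lia|apply: farc; lia].
have cu := jump u su ltac:(lia) lesu ltac:(lia) ltac:(lia).
have cv := jump v sv ltac:(lia) lesv ltac:(lia) ltac:(lia).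
have := conn_trans (conn_trans (conn_sym adj_sym c1) cu)
  (conn_trans cb (conn_sym adj_sym (conn_trans c2 cv))).
move=> H.
have gI : geod (fun t => c (p - D + t)) (2 * D).
  by apply: (geod_shift gc); lia.
have := @dD D (fun t => c (p - D + t))
  (p - D - u + d (c u) (b su) + (M + (v - (p + D) + d (c v) (b sv)))) leD gI.
rewrite /= addn0 subnK; last by lia.
have -> : p - D + 2 * D = p + D by lia.
move=> /(_ H) le; apply: leq_trans le _; rewrite leq_mul2l; apply/orP; right; lia.
Qed.

(** Large enough for [detour] to apply and to absorb the rounding of [w] in the next proof. *)
Definition kappa0 := r0 + 64 * q + 1.

(** Otherwise a point [ca p] almost farthest from the path [b'], at distance [D], yields a detour of
    length about [10 * D]. Only the excluded end, of length [h], depends on [K]; the bound [kappa0]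
    does not. *)
Lemma contraction K : exists h, forall x a b na nb ca cb t0,
  d a b <= K -> geod ca na -> ca 0 = x -> ca na = a ->
  geod cb nb -> cb 0 = x -> cb nb = b -> t0 + h <= na ->
  exists2 s, s <= nb & d (ca t0) (cb s) < kappa0.
Proof.
pose DK := 4 * q * K.
exists (64 * q * DK + 10 * DK + 2 * K + kappa0 + 1) => x a b na nb ca cb t0.
move=> leK gca ca0 can gcb cb0 cbn let0.
case: (boolP [exists s : 'I_nb.+1, d (ca t0) (cb s) < kappa0]) => [/existsP[s Hs]|].
  by exists s => //; rewrite -ltnS.
rewrite negb_exists => /forallP far; exfalso.
have {}far s : s <= nb -> kappa0 <= d (ca t0) (cb s).
  by move=> les; have := far (Ordinal (les : s < nb.+1)); rewrite -leqNgt.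
have [cl [gcl cl0 cln]] := dG b a; set m := d b a in gcl cln.
have lemK : m <= K by rewrite /m dC.
have daE : na = d x a by rewrite -ca0 -can gca // subn0.
have dbE : nb = d x b by rewrite -cb0 -cbn gcb // subn0.
(* [cb] prolonged to [a] by a geodesic of length at most [K]: a path with the ends of [ca], geodesic
   up to [2 * K]. *)
pose b' i := if i <= nb then cb i else cl (i - nb).
have b'0 : b' 0 = x by rewrite /b' leq0n.
have b'n : b' (nb + m) = a.
  rewrite /b'; case: leqP => le; last by rewrite addKn.
  have m0 : m = 0 by lia.
  by rewrite m0 addn0 cbn -cl0 -cln m0.
have b'l i : nb <= i -> b' i = cl (i - nb).
  rewrite /b' => le; case: leqP => // le'; have -> : i = nb by lia.
  by rewrite subnn cl0.
have adjb k : k < nb + m -> adj (b' k) (b' k.+1).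
  move=> ltk; case: (ltnP k nb) => ltkn.
    by rewrite /b' ltkn (ltnW ltkn); apply: geod_adj gcb _.
  rewrite !b'l; [|lia|lia]; rewrite subSn //; apply: geod_adj gcl _; lia.
have lipb i j : i <= j -> j <= nb + m -> d (b' i) (b' j) <= j - i.
  move=> leij; have {leij} [k ->] : exists k, j = i + k by exists (j - i); lia.
  elim: k => [|k IHk] lek; first by rewrite addn0 d0.
  have := dT (b' i) (b' (i + k)) (b' (i + k.+1)).
  have := adjb (i + k) ltac:(lia); rewrite /adj addnS; have := IHk ltac:(lia); lia.
have qgb i j : i <= j -> j <= nb + m -> j - i <= d (b' i) (b' j) + 2 * K.
  move=> leij lej; have := lipb 0 i ltac:(lia) ltac:(lia).
  have := lipb j (nb + m) ltac:(lia) ltac:(lia).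
  rewrite b'0 b'n => h1 h2; have := dT x (b' i) a; have := dT (b' i) (b' j) a.
  have := dT x a b; rewrite (dC a b) -/m; lia.
pose su t : nat := [arg min_(i < ord0 : 'I_(nb + m).+1) d (ca t) (b' i)].
have suP t : su t <= nb + m /\ forall k, k <= nb + m -> d (ca t) (b' (su t)) <= d (ca t) (b' k).
  rewrite /su; case: arg_minnP => // i _ mini; split; first by rewrite -ltnS.
  by move=> k lek; apply: (mini (Ordinal (lek : k < (nb + m).+1))).
pose f t := d (ca t) (b' (su t)).
have fle t k : k <= nb + m -> f t <= d (ca t) (b' k) by apply: (suP t).2.
pose Q := 64 * q.
(* The penalty [|t - t0|] keeps [p] near [t0] unless [D] is large, and lets [f t] exceed [D] by at
   most [|t - p| / Q]. *)
have [p lepn maxp] := arg_max_nat (fun t => Q * f t + (na - ((t - t0) + (t0 - t)))) na.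
set D := f p.
have far' : kappa0 <= f t0.
  have := (suP t0).1; rewrite /f => lesu; case: (leqP (su t0) nb) => le.
    by rewrite /b' le far.
  rewrite b'l; last by lia.
  have := dT (ca t0) (cl (su t0 - nb)) a.
  rewrite -{1}can gca; [|lia|lia].
  rewrite -cln gcl; lia.
have leD : kappa0 <= D.
  have := maxp t0 ltac:(lia); rewrite subnn addn0 subn0 -/D; rewrite /Q => H.
  suff: f t0 <= D by lia.
  by rewrite -(@leq_pmul2l (64 * q)); lia.
have Dx : D <= p.
  by have := fle p 0 (leq0n _); rewrite b'0 -ca0 dC gca // subn0.
have Da : D <= na - p.
  by have := fle p (nb + m) (leqnn _); rewrite b'n -can gca.
have fux t : t <= na -> Q * f t <= Q * D + ((p - t) + (t - p)).
  by move=> let_; have := maxp t let_; rewrite -/D; lia.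
(* The first inequality is [(2 * D + w) / Q <= w], so that [f <= D + w] up to distance
   [A = 2 * D + w] from [p]; the second makes [w] negligible against [D / q]. *)
have [w wE wle] : exists2 w, 2 * D <= (Q - 1) * w & 16 * (q * w) <= D.
  exists ((2 * D) %/ (Q - 1)).+1.
    by rewrite [(_ - _) * _]mulnC; apply/ltnW; apply: ltn_ceil; rewrite /Q; lia.
  have := leq_divM (2 * D) (Q - 1).
  rewrite /Q; move: leD; rewrite /kappa0 /Q.
  move: (2 * D %/ _) => z; nia.
pose A := 2 * D + w.
(* Where [u] or [v] is truncated to an end of [ca], [f] vanishes: this is the first alternative in
   [Hu] and [Hv]. *)
have [u uE] : exists u, u = p - A by exists (p - A).
have [v vE] : exists v, v = minn na (p + A) by exists (minn na (p + A)).
have AE : A = 2 * D + w by [].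
have fA t : t <= na -> (p - t) + (t - p) <= A -> f t <= D + w.
  move=> let_ leA; have := fux _ let_.
  rewrite /A in leA; move: wE.
  rewrite mulnBl mul1n => wE H; have lew : w <= Q * w by rewrite leq_pmull /Q; lia.
  rewrite -(@leq_pmul2l Q); last by rewrite /Q; lia.
  rewrite mulnDr; lia.
have fu := fA u ltac:(lia) ltac:(lia).
have fv := fA v ltac:(lia) ltac:(lia).
have Hu : d (ca u) (b' (su u)) = 0 \/ D + d (ca u) (b' (su u)) <= p - u.
  case: (leqP A p) => le; [right; rewrite -/(f u); lia|left].
  have -> : u = 0 by lia.
  by have := fle 0 0 (leq0n _); rewrite b'0 -ca0 d0 /f; lia.
have Hv : d (ca v) (b' (su v)) = 0 \/ D + d (ca v) (b' (su v)) <= v - p.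
  case: (leqP (p + A) na) => le; [right; rewrite -/(f v); lia|left].
  have -> : v = na by lia.
  by have := fle na (nb + m) (leqnn _); rewrite b'n -can d0 /f; lia.
have duv : d (b' (su u)) (b' (su v)) <= 2 * A + 2 * (D + w).
  have := dT (b' (su u)) (ca u) (b' (su v)); have := dT (ca u) (ca v) (b' (su v)).
  rewrite (dC (b' (su u)) (ca u)) -/(f u) -/(f v) gca; lia.
have main M : (su u - su v) + (su v - su u) <= M ->
    (10 * q + 1) * D <= q * ((v - u) - 2 * D + f u + f v + M).
  apply: (@detour_path ca na b' (nb + m) p u v (su u) (su v) D M) => //.
  - by move: leD; rewrite /kappa0; lia.
  - lia.
  - lia.
  - lia.
  - exact: (suP u).1.
  - exact: (suP v).1.
  - by move=> k lek; apply: fle.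
have [les les'] := ((suP u).1, (suP v).1).
(* The detour has length at most [10 * D + 8 * w], plus [2 * K] as [b'] is only almost geodesic. For
   [D > DK] the surplus [D / q] absorbs this error. Otherwise [p] is not far beyond [t0], hence far
   from [a], and both feet lie on the geodesic [cb]. *)
case: (ltnP DK D) => [bigD|smallD].
  have : su u - su v + (su v - su u) <= 2 * A + 2 * (D + w) + 2 * K.
    case: (leqP (su u) (su v)) => le.
      have := qgb _ _ le les'; lia.
    have := qgb _ _ (ltnW le) les; rewrite dC; lia.
  move/main; rewrite leqNgt => /negP; apply.
  apply: (@leq_ltn_trans (q * (10 * D + 8 * w + 2 * K))).
    by rewrite leq_mul2l; apply/orP; right; lia.
  by move: bigD wle; rewrite /DK; clear; nia.
have nearp : p <= t0 + Q * DK.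
  have := maxp t0 ltac:(lia); rewrite subnn addn0 subn0 -/D => H.
  have : Q * D <= Q * DK by rewrite leq_mul2l smallD orbT.
  by move: leD far'; lia.
have in_cb t : t <= na -> t <= p + A -> f t <= D + w -> su t <= nb.
  move=> let_ letA left_; rewrite leqNgt; apply/negP => lt.
  have := (suP t).1 => les''.
  have H : d (b' (su t)) a <= K.
    by rewrite b'l ?(ltnW lt) // -cln gcl; lia.
  have := dT (ca t) (b' (su t)) a; rewrite -/(f t) -{1}can gca //.
  have : w <= D by move: wle q_gt0; clear; nia.
  rewrite /Q in nearp; rewrite /A in letA; lia.
have leu := in_cb u ltac:(lia) ltac:(lia) fu.
have lev := in_cb v ltac:(lia) ltac:(lia) fv.
have : su u - su v + (su v - su u) <= 2 * A + 2 * (D + w).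
  move: duv; rewrite /b' leu lev.
  case: (leqP (su u) (su v)) => le; first by rewrite gcb; lia.
  by rewrite dC gcb; lia.
move/main; rewrite leqNgt => /negP; apply.
apply: (@leq_ltn_trans (q * (10 * D + 8 * w))).
  by rewrite leq_mul2l; apply/orP; right; lia.
by move: leD wle; rewrite /kappa0; clear; nia.
Qed.

End Detour.
End Metric.

(** * Exponential divergence of geodesics and corners of triangles *)

Section Divergence.
Variables (T : Type) (d : T -> T -> nat).
Hypotheses (dM : is_metric d) (dG : geodesic_space d).
Let d0 x : d x x = 0. Proof. by case: dM. Qed.
Let dC x y : d x y = d y x. Proof. by case: dM. Qed.
Let dT x y z : d x z <= d x y + d y z. Proof. by case: dM. Qed.
Section Detour.
Variables (q r0 : nat).
Hypotheses (q_gt0 : 0 < q) (dD : detour d q r0).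

Definition kappa := 2 * kappa0 q r0.

(** Points closer than [kappa0] have distances to [x] differing by less than [kappa0], so comparing
    equal parameters costs a factor 2. *)
Lemma contraction_level K : exists h, forall x a b na nb ca cb t,
  d a b <= K -> geod d ca na -> ca 0 = x -> ca na = a ->
  geod d cb nb -> cb 0 = x -> cb nb = b -> t + h <= na -> t <= nb ->
  d (ca t) (cb t) <= kappa.
Proof.
have [h contr] := contraction dM dG q_gt0 dD K; exists h.
move=> x a b na nb ca cb t leK gca ca0 can gcb cb0 cbn leh len.
have [s les lts] := contr _ _ _ _ _ _ _ _ leK gca ca0 can gcb cb0 cbn leh.
have dt : d x (ca t) = t by rewrite -ca0 gca //; lia.
have ds : d x (cb s) = s by rewrite -cb0 gcb //; lia.
have := dT x (ca t) (cb s); have := dT x (cb s) (ca t); rewrite (dC (cb s) (ca t)).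
have := dT (ca t) (cb s) (cb t); rewrite /kappa.
have : d (cb s) (cb t) = (s - t) + (t - s).
  by case: (leqP s t) => le; [|rewrite dC]; rewrite gcb //; lia.
lia.
Qed.

(** Induction on [j], halving the path at [w]. At level [t + h] the geodesics to [y] and [z] are
    [kappa]-close to the one to [w], hence [2 * kappa]-close to each other; [contraction_level] for
    [K = 2 * kappa] restores [kappa] at level [t]. *)
Lemma exponential_divergence : exists h, forall x rho j n y z ny nz cy cz t,
  geod d cy ny -> cy 0 = x -> cy ny = y -> geod d cz nz -> cz 0 = x -> cz nz = z ->
  conn (adj d) (fun v => rho <= d x v) n y z -> n <= 2 ^ j ->
  t + j.+1 * h <= rho -> d (cy t) (cz t) <= kappa.
Proof.
have [h1 contr1] := contraction_level 1.
have [h2 contr2] := contraction_level (2 * kappa).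
exists (maxn h1 h2) => x rho j; elim: j => [|j IHj] n y z ny nz cy cz t
  gcy cy0 cyn gcz cz0 czn cyz len let_.
  have nyE : ny = d x y by rewrite -cy0 -cyn gcy // subn0.
  have nzE : nz = d x z by rewrite -cz0 -czn gcz // subn0.
  have := conn_endl cyz; have := conn_endr cyz => lez ley.
  apply: (contr1 x y z ny nz) => //; [|lia|lia].
  by apply: conn1 (conn_le len cyz) => v; rewrite /adj d0.
have cyz' : conn (adj d) (fun v => rho <= d x v) (2 ^ j + 2 ^ j) y z.
  by apply: conn_le cyz; move: len; rewrite expnS; lia.
have [w [lew cyw cwz]] := conn_split cyz'.
have [cw [gcw cw0 cwn]] := dG x w.
set h := maxn h1 h2 in IHj let_ *.
pose t' := t + h.
have let' : t' + j.+1 * h <= rho by move: let_; rewrite /t'; lia.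
have H1 := IHj _ _ _ _ _ _ _ _ gcy cy0 cyn gcw cw0 cwn cyw (leqnn _) let'.
have H2 := IHj _ _ _ _ _ _ _ _ gcw cw0 cwn gcz cz0 czn cwz (leqnn _) let'.
have nyE : ny = d x y by rewrite -cy0 -cyn gcy // subn0.
have nzE : nz = d x z by rewrite -cz0 -czn gcz // subn0.
have := conn_endl cyz; have := conn_endr cyz => lez ley.
apply: (contr2 x (cy t') (cz t') t' t') => //.
- have := dT (cy t') (cw t') (cz t'); lia.
- by apply: geod_trunc gcy _; lia.
- by apply: geod_trunc gcz _; lia.
- by rewrite /t' /h; lia.
- by rewrite /t' leq_addr.
Qed.

(* Sides c : x ~> y and c' : x ~> z; the side opposite to x has length m, so
   that twice the Gromov product of y and z at x is n + n' - m. *)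
Definition corner (c c' : nat -> T) n n' m g :=
  exists t, [/\ 2 * t + m <= n + n', n + n' <= 2 * t + m + 2 * g
              & d (c t) (c' t) <= kappa].

(** Let [rho] be the rounded Gromov product at [c1 0]. Following [c1], [c2], [c3], with jumps at the
    other two corners, connects the points at level [rho] by a path of length about [4 * g] outside
    a ball of radius [rho - kappa]. Divergence costs only a logarithm of [g], which is below [g] for
    large [g]. *)
Lemma corner_step : exists g0, forall g, g0 <= g ->
  forall c1 c2 c3 n1 n2 n3,
  geod d c1 n1 -> geod d c2 n2 -> geod d c3 n3 ->
  c1 n1 = c2 0 -> c2 n2 = c3 0 -> c3 n3 = c1 0 ->
  corner c2 (fun t => c1 (n1 - t)) n2 n1 n3 g.+1 ->
  corner c3 (fun t => c2 (n2 - t)) n3 n2 n1 g.+1 ->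
  corner c1 (fun t => c3 (n3 - t)) n1 n3 n2 g.
Proof.
have [h div] := exponential_divergence.
(* [4 * g + 2 * kappa + 12] bounds the length of that path, and [h * j + h + kappa + 1] the loss by
   divergence and rounding. *)
have [g0 g0P] := linear_log h (h + kappa + 1) 4 (2 * kappa + 12).
exists g0 => g leg c1 c2 c3 n1 n2 n3 gc1 gc2 gc3 e12 e23 e31.
move=> [ty [ty1 ty2 ty3]] [tz [tz1 tz2 tz3]].
have n1E : n1 = d (c1 0) (c1 n1) by rewrite gc1 // subn0.
have n2E : n2 = d (c2 0) (c2 n2) by rewrite gc2 // subn0.
have n3E : n3 = d (c3 0) (c3 n3) by rewrite gc3 // subn0.
rewrite e12 in n1E; rewrite e23 in n2E; rewrite e31 in n3E.
have tr1 : n1 <= n2 + n3.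
  by have := dT (c1 0) (c3 0) (c2 0); rewrite (dC (c1 0) (c3 0)) (dC (c3 0) (c2 0)); lia.
have tr2 : n2 <= n1 + n3.
  by have := dT (c2 0) (c1 0) (c3 0); rewrite (dC (c2 0) (c1 0)) (dC (c1 0) (c3 0)); lia.
have tr3 : n3 <= n1 + n2.
  by have := dT (c3 0) (c2 0) (c1 0); rewrite (dC (c3 0) (c2 0)) (dC (c2 0) (c1 0)); lia.
have [rho [rho1 rho2]] : exists rho, 2 * rho + n2 <= n1 + n3 /\ n1 + n3 <= 2 * rho + n2 + 1.
  by exists ((n1 + n3 - n2) %/ 2); lia.
have [j [leg4 legj]] := g0P g leg.
pose P v := rho - kappa <= d (c1 0) v.
have Pc1 k : rho <= k -> k <= n1 -> P (c1 k) by move=> ? ?; rewrite /P gc1; lia.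
have Pc3 k : k + rho <= n3 -> P (c3 k).
  by move=> ?; rewrite /P -e31 dC gc3; lia.
have Pc2 k : k <= n2 -> rho <= d (c1 0) (c2 k).
  move=> lek; have e1 : d (c2 0) (c2 k) = k by rewrite gc2 // subn0.
  have e2 : d (c2 k) (c3 0) = n2 - k by rewrite -e23 gc2.
  have := dT (c1 0) (c2 k) (c2 0); have := dT (c1 0) (c2 k) (c3 0).
  rewrite (dC (c2 k) (c2 0)) e1 e2 (dC (c1 0) (c3 0)); lia.
have jump a b : rho <= d (c1 0) a -> d a b <= kappa -> conn (adj d) P kappa a b.
  move=> lea leab; apply: (conn_le leab); apply: (dist_conn dG) => v Hv; rewrite /P.
  by have := dT (c1 0) v a; rewrite (dC v a); lia.
have p1 : conn (adj d) P (n1 - ty - rho) (c1 rho) (c1 (n1 - ty)).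
  by apply: (geod_conn gc1) => [||k ? ?]; [lia|lia|apply: Pc1; lia].
have p2 := jump (c2 ty) (c1 (n1 - ty)) ltac:(apply: Pc2; lia) ty3.
have p3 : conn (adj d) P (n2 - tz - ty) (c2 ty) (c2 (n2 - tz)).
  apply: (geod_conn gc2) => [||k ? ?]; [lia|lia|].
  by rewrite /P; have := Pc2 k ltac:(lia); lia.
have p4 := jump (c2 (n2 - tz)) (c3 tz) ltac:(apply: Pc2; lia) ltac:(by rewrite dC).
have p5 : conn (adj d) P (n3 - rho - tz) (c3 tz) (c3 (n3 - rho)).
  by apply: (geod_conn gc3) => [||k ? ?]; [lia|lia|apply: Pc3; lia].
have := conn_trans p1 (conn_trans (conn_sym (@adj_sym _ _ dM) p2)
  (conn_trans p3 (conn_trans p4 p5))).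
move=> H; have {}H := conn_le (_ : _ <= 2 ^ j) H.
have {}H := H ltac:(lia).
case: (leqP (kappa + j.+1 * h) rho) => le; last first.
  by exists 0; split; [lia|lia|rewrite subn0 e31 d0].
exists (rho - kappa - j.+1 * h); split; [lia|lia|].
apply: (div (c1 0) (rho - kappa) j _ _ _ rho rho c1 (fun t => c3 (n3 - t))
  _ _ _ _ _ _ _ H (leqnn _)) => //.
- by apply: geod_trunc gc1 _; lia.
- apply: (@geod_trunc _ _ _ n3); last by lia.
  exact: geod_rev.
- by rewrite subn0.
- by lia.
Qed.

(** For a huge [g] all corners are satisfied with [t = 0]; [corner_step], applied cyclically, lowers
    [g] to the uniform [g0]. *)
Lemma corner_bounded : exists g0, forall c1 c2 c3 n1 n2 n3,
  geod d c1 n1 -> geod d c2 n2 -> geod d c3 n3 ->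
  c1 n1 = c2 0 -> c2 n2 = c3 0 -> c3 n3 = c1 0 ->
  corner c1 (fun t => c3 (n3 - t)) n1 n3 n2 g0.
Proof.
have [g0 step] := corner_step; exists g0 => c1 c2 c3 n1 n2 n3 gc1 gc2 gc3 e12 e23 e31.
pose all3 g := [/\ corner c1 (fun t => c3 (n3 - t)) n1 n3 n2 g,
  corner c2 (fun t => c1 (n1 - t)) n2 n1 n3 g
  & corner c3 (fun t => c2 (n2 - t)) n3 n2 n1 g].
have down g : g0 <= g -> all3 g.+1 -> all3 g.
  move=> leg [h1 h2 h3]; split.
  - exact: (step _ leg c1 c2 c3).
  - exact: (step _ leg c2 c3 c1).
  - exact: (step _ leg c3 c1 c2).
have n1E : n1 = d (c1 0) (c2 0) by rewrite -e12 gc1 // subn0.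
have n2E : n2 = d (c2 0) (c3 0) by rewrite -e23 gc2 // subn0.
have n3E : n3 = d (c3 0) (c1 0) by rewrite -e31 gc3 // subn0.
have tr1 : n1 <= n2 + n3.
  by have := dT (c1 0) (c3 0) (c2 0); rewrite (dC (c1 0) (c3 0)) (dC (c3 0) (c2 0)); lia.
have tr2 : n2 <= n1 + n3.
  by have := dT (c2 0) (c1 0) (c3 0); rewrite (dC (c2 0) (c1 0)) (dC (c1 0) (c3 0)); lia.
have tr3 : n3 <= n1 + n2.
  by have := dT (c3 0) (c2 0) (c1 0); rewrite (dC (c3 0) (c2 0)) (dC (c2 0) (c1 0)); lia.
have start : all3 (g0 + (n1 + n2 + n3)).
  by split; exists 0; rewrite /= subn0 ?e31 ?e12 ?e23 d0; split=> //; lia.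
move: (n1 + n2 + n3) start => N; elim: N => [|N IHN]; first by rewrite addn0 => -[].
by rewrite addnS => /(down _ (leq_addr _ _))/IHN.
Qed.

(** The levels [s] and [t] are within [g0] of the Gromov products of [x], [y] and of [y], [z] at
    [o]. The path from [x] through [cx s], [cy s], [cy t] and [cz t] to [z] bounds [d x z]. *)
Lemma detour_hyperbolic : exists D, hyp4 d D.
Proof.
have [g0 bd] := corner_bounded; exists (2 * g0 + 2 * kappa) => o x y z.
have [cx [gx x0 xn]] := dG o x; have [cy [gy y0 yn]] := dG o y.
have [cz [gz z0 zn]] := dG o z.
have tri u v cu cv : geod d cu (d o u) -> cu 0 = o -> cu (d o u) = u ->
    geod d cv (d o v) -> cv 0 = o -> cv (d o v) = v ->
    corner cu cv (d o u) (d o v) (d u v) g0.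
  move=> gu u0 un gv v0 vn; have [c [gc c0 cn]] := dG u v.
  have gv' := @geod_rev _ _ dM _ _ gv.
  have := bd cu c _ _ _ _ gu gc gv'; rewrite subn0 un c0 cn vn subnn v0 u0.
  move=> /(_ erefl erefl erefl) [t [t1 t2 t3]]; exists t; split=> //.
  have := dT u o v; rewrite (dC u o) => _.
  have : t <= d o v by have := dT o u v; have := dT o v u; rewrite (dC v u); lia.
  by move=> let_; move: t3; rewrite subKn.
have [s [s1 s2 s3]] := tri x y cx cy gx x0 xn gy y0 yn.
have [t [t1 t2 t3]] := tri y z cy cz gy y0 yn gz z0 zn.
have les : s <= d o x by have := dT o x y; have := dT o y x; rewrite (dC y x); lia.
have les' : s <= d o y by have := dT o x y; have := dT o y x; rewrite (dC y x); lia.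
have let_ : t <= d o z by have := dT o z y; have := dT o y z; rewrite (dC z y); lia.
have let' : t <= d o y by have := dT o z y; have := dT o y z; rewrite (dC z y); lia.
have dx : d x (cx s) = d o x - s by rewrite dC -{1}xn gx.
have dz : d (cz t) z = d o z - t by rewrite -{1}zn gz.
have dy : d (cy s) (cy t) = (s - t) + (t - s).
  by case: (leqP s t) => le; [|rewrite dC]; rewrite gy //; lia.
have := dT x (cx s) z; have := dT (cx s) (cy s) z; have := dT (cy s) (cy t) z.
have := dT (cy t) (cz t) z; lia.
Qed.

End Detour.
End Divergence.

(** * Paths in hyperbolic spaces *)

Section Hyperbolic.
Variables (T : Type) (d d' : T -> T -> nat) (D : nat).
Hypotheses (dM : is_metric d) (dG : geodesic_space d) (dH : hyp4 d D).
Let d0 x : d x x = 0. Proof. by case: dM. Qed.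
Let dC x y : d x y = d y x. Proof. by case: dM. Qed.
Let dT x y z : d x z <= d x y + d y z. Proof. by case: dM. Qed.

(** Bisection of the chain: each halving uses the four-point condition once and costs [D]. *)
Lemma gromov_product_conn c P o r k n x y :
  conn (fun a b => d a b <= c) P n x y -> n <= 2 ^ k ->
  (forall v, P v -> r <= d o v) ->
  d x y + 2 * r <= d o x + d o y + c + k * D.
Proof.
move=> cxy len Pr; elim: k n x y cxy len => [|k IHk] n x y cxy len.
  have := Pr _ (conn_endl cxy); have := Pr _ (conn_endr cxy).
  have : d x y <= c by apply: conn1 (conn_le len cxy) => v; rewrite d0.
  lia.
have {}cxy : conn (fun a b => d a b <= c) P (2 ^ k + 2 ^ k) x y.
  by apply: conn_le cxy; move: len; rewrite expnS; lia.
have [w [_ cxw cwy]] := conn_split cxy.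
have := IHk _ _ _ cxw (leqnn _); have := IHk _ _ _ cwy (leqnn _).
have := dH o x w y; lia.
Qed.

Variable c : nat.
Hypotheses (ledd' : forall x y, d x y <= c * d' x y)
  (led'd : forall x y, d' x y <= c * d x y).

(** A weak Morse lemma, with an error linear in [k], hence logarithmic in the length. If [gam]
    stayed farther than [B] from a point [q j] of a [d]-geodesic, [gromov_product_conn] would make
    the product of [x] and [y] at [q j] positive. *)
Lemma quasigeodesic_gromov_product k l h gam : geod d' gam l -> h <= l -> l <= 2 ^ k ->
  d (gam 0) (gam h) + d (gam h) (gam l) <= d (gam 0) (gam l) +
    2 * ((c + k * D) + c * (c * (2 * (c + k * D) + 1))).
Proof.
move=> gg lehl lelk; set B := c + k * D.
set x := gam 0; set y := gam l.
have [q [gq q0 qn]] := dG x y; set N := d x y in gq qn.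
have near j : j <= N -> exists2 t, t <= l & d (q j) (gam t) <= B.
  move=> lej; case: (boolP [exists t : 'I_l.+1, d (q j) (gam t) <= B]).
    by move=> /existsP[t Ht]; exists t => //; rewrite -ltnS.
  rewrite negb_exists => /forallP far; exfalso.
  have cg : conn (fun a b => d a b <= c) (fun v => B.+1 <= d (q j) v) (l - 0) x y.
    apply: conn_fun => // t _ ltl; first by have := ledd' (gam t) (gam t.+1);
      rewrite gg // subSnn muln1.
    by rewrite ltnNge; apply: (far (Ordinal (ltl : t < l.+1))).
  have := gromov_product_conn cg _ (fun v H => H) (k := k) (o := q j).
  rewrite subn0 => /(_ lelk); rewrite -/N.
  have -> : d (q j) x = j by rewrite dC -q0 gq // subn0.
  have -> : d (q j) y = N - j by rewrite -{1}qn gq.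
  rewrite /B; lia.
(* At the first such [j], the predecessor of [q j] is near a point of [gam] before [h], so [gam h]
   is caught between two points close to each other. *)
pose hi j := [exists t : 'I_l.+1, (h <= t) && (d (q j) (gam t) <= B)].
have hiN : exists j, hi j.
  by exists N; apply/existsP; exists ord_max; rewrite /= lehl qn d0.
have hiN' : hi N by apply/existsP; exists ord_max; rewrite /= lehl qn d0.
case: (ex_minnP hiN) => j /existsP[t2 /andP[let2 dt2]] minj.
have lejN : j <= N := minj _ hiN'.
have [i [t1 [leiN letl1 let1 dt1 dij]]] : exists i t1,
    [/\ i <= N, t1 <= l, t1 <= h, d (q i) (gam t1) <= B & d (q i) (q j) <= 1].
  case: j lejN minj dt2 => [|j] lejN minj dt2.
    by exists 0, 0; split=> //; rewrite ?q0 d0.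
  have [t lt dt] := near j (ltnW lejN); exists j, t; split=> //; first exact: ltnW.
    rewrite leqNgt; apply/negP => ltht.
    suff /minj : hi j by rewrite ltnn.
    by apply/existsP; exists (Ordinal (lt : t < l.+1)); rewrite /= (ltnW ltht).
  by rewrite gq //; lia.
have lt2l : t2 <= l by rewrite -ltnS.
have d12 : d (gam t1) (gam t2) <= 2 * B + 1.
  have := dT (gam t1) (q i) (gam t2); have := dT (q i) (q j) (gam t2).
  rewrite (dC (gam t1) (q i)); lia.
have l12 : h - t1 <= c * (2 * B + 1).
  have := led'd (gam t1) (gam t2); rewrite gg //; last exact: leq_trans let2.
  have : c * d (gam t1) (gam t2) <= c * (2 * B + 1) by rewrite leq_mul2l d12 orbT.
  lia.
have d1h : d (gam t1) (gam h) <= c * (c * (2 * B + 1)).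
  by apply: leq_trans (ledd' _ _) _; rewrite gg // leq_mul2l l12 orbT.
have := dT (q i) (gam t1) (gam h).
have := dT x (q i) (gam h); have := dT (gam h) (q i) y; rewrite (dC (gam h) (q i)).
have -> : d x (q i) = i by rewrite -q0 gq // subn0.
have -> : d (q i) y = N - i by rewrite -{1}qn gq.
lia.
Qed.

(** Seen from the midpoint, the ends have a Gromov product of order at most [k], as [gam] is a
    quasigeodesic, but of order at least [l] if a path of length at most [2 ^ k] avoids the ball.
    For large [l] a [k] small against [l] is available, a contradiction. *)
Lemma avoiding_path_superlinear K : exists L, forall l gam n, L <= l -> geod d' gam l ->
  conn (adj d') (fun v => l <= 2 * d' (gam l./2) v + 1) n (gam 0) (gam l) -> K * l <= n.
Proof.
have [L LP] := linear_log ((2 * c + 2) * (D * (3 + 4 * c * c)))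
  ((2 * c + 2) * (2 * c + c + 2 * c * c * (2 * c + 2) + 2) + 1) (K + 1) 0.
exists L.+1 => l gam n leL gg cn; rewrite leqNgt; apply/negP => ltn.
have [k [lek ltl]] := LP l (ltnW leL).
pose r := l %/ (2 * c + 2).
have cE : conn (fun a b => d a b <= c) (fun v => r <= d (gam l./2) v) n (gam 0) (gam l).
  apply: (@conn_rel _ (adj d')).
    by move=> a b ab; have := ledd' a b; move: ab; rewrite /adj;
       case: (d' a b) => [|[|//]]; rewrite ?muln1 // muln0; case: (d a b).
  apply: conn_mono cn => v Hv; have := led'd (gam l./2) v.
  have := leq_divM l (2 * c + 2); rewrite -/r.
  rewrite [r <= _]leqNgt => h1 h2; apply/negP => lt.
  have : (d (gam l./2) v).+1 * (2 * c + 2) <= r * (2 * c + 2) by rewrite leq_mul2r lt orbT.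
  lia.
have len : n <= 2 ^ k by lia.
have := gromov_product_conn cE len (fun v H => H).
have := @quasigeodesic_gromov_product k l l./2 gam gg ltac:(lia) ltac:(lia).
rewrite (dC (gam l./2) (gam 0)) => up low.
have le_r : 2 * r <= 2 * (c + k * D + c * (c * (2 * (c + k * D) + 1))) + c + k * D by lia.
have : l < r.+1 * (2 * c + 2) by apply: ltn_ceil; rewrite addn2.
have : (2 * c + 2) * (2 * r) <=
    (2 * c + 2) * (2 * (c + k * D + c * (c * (2 * (c + k * D) + 1))) + c + k * D).
  by rewrite leq_mul2l le_r orbT.
lia.
Qed.

End Hyperbolic.

Local Open Scope classical_set_scope.

(** * Word metrics *)

Section WordEval.
Variables (G : groupType) (A : set G).
Implicit Types (g h x y : G) (w : seq G).

Lemma word_eval_nil : word_eval [::] = 1%g :> G.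
Proof. by rewrite /word_eval big_nil. Qed.

Lemma word_eval_cons s w : word_eval (s :: w) = (s * word_eval w)%g.
Proof. by rewrite /word_eval big_cons. Qed.

Lemma word_eval_cat w w' : word_eval (w ++ w') = (word_eval w * word_eval w')%g.
Proof. by rewrite /word_eval big_cat. Qed.

Lemma is_word_cat w w' : is_word A w -> is_word A w' -> is_word A (w ++ w').
Proof. by move=> Aw Aw' s; rewrite mem_cat => /orP[/Aw|/Aw']. Qed.

Lemma is_word_cons s w : A s -> is_word A w -> is_word A (s :: w).
Proof. by move=> As Aw t; rewrite inE => /orP[/eqP -> //|/Aw]. Qed.

Lemma is_word_cons_inv s w : is_word A (s :: w) -> A s /\ is_word A w.
Proof.
by move=> Aw; split=> [|t tw]; apply: Aw; rewrite inE ?eqxx // tw orbT.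
Qed.

Definition inv_word w : seq G := rev [seq (s^-1)%g | s <- w].

Lemma word_eval_inv w : word_eval (inv_word w) = ((word_eval w)^-1)%g.
Proof.
elim: w => [|s w IHw]; first by rewrite /inv_word /= word_eval_nil invg1.
rewrite /inv_word /= rev_cons -cats1 word_eval_cat -/(inv_word w) IHw.
by rewrite !word_eval_cons word_eval_nil mulg1 invgM.
Qed.

Lemma size_inv_word w : size (inv_word w) = size w.
Proof. by rewrite size_rev size_map. Qed.

Hypotheses (Asym : symmetric_set A) (Agen : generates A).

Lemma is_word_inv w : is_word A w -> is_word A (inv_word w).
Proof.
by move=> Aw s; rewrite mem_rev => /mapP[t tw ->]; apply/Asym/Aw.
Qed.

Lemma words_to_ex g : exists w, words_to A g w.
Proof.
suff: g \in [pred g | `[< exists w, words_to A g w >]].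
  by rewrite unfold_in => /asboolP.
apply: Agen.
- split=> [|x y].
    by rewrite unfold_in; apply/asboolP; exists [::]; split=> //; rewrite word_eval_nil.
  rewrite !unfold_in => /asboolP[w [Aw wx]] /asboolP[w' [Aw' w'y]]; apply/asboolP.
  exists (w ++ inv_word w'); split; first exact: is_word_cat (is_word_inv _).
  by rewrite word_eval_cat word_eval_inv wx w'y.
- move=> s As; rewrite unfold_in; apply/asboolP; exists [:: s].
  by split; [apply: is_word_cons|rewrite word_eval_cons word_eval_nil mulg1].
Qed.

(** As [A] is symmetric and generates, the set under [xget] is inhabited and the default value is
    never taken. *)
Lemma word_lengthP g : (exists2 w, words_to A g w & size w = word_length A g) /\
  (forall w, words_to A g w -> word_length A g <= size w).
Proof.
have ex : exists n, `[< exists2 w, words_to A g w & size w = n >].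
  by have [w wg] := words_to_ex g; exists (size w); apply/asboolP; exists w.
pose P := [set n | (exists2 w, words_to A g w & size w = n) /\
                   (forall w, words_to A g w -> n <= size w)].
suff exP : exists n, P n by have := xgetPex 0 exP.
exists (ex_minn ex); case: ex_minnP => n /asboolP nP min_n; split=> // w wg.
by apply: min_n; apply/asboolP; exists w.
Qed.

Lemma word_length_le g w : words_to A g w -> word_length A g <= size w.
Proof. exact: (word_lengthP g).2. Qed.

Lemma word_length1 : word_length A 1%g = 0.
Proof.
by apply/eqP; rewrite -leqn0 (@word_length_le _ [::]) //; split; rewrite ?word_eval_nil.
Qed.

Lemma word_lengthM g h : word_length A (g * h)%g <= word_length A g + word_length A h.
Proof.
have [[w [Aw wg] <-] _] := word_lengthP g; have [[w' [Aw' wh] <-] _] := word_lengthP h.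
rewrite -size_cat; apply: word_length_le; split; first exact: is_word_cat.
by rewrite word_eval_cat wg wh.
Qed.

Lemma word_lengthV g : word_length A (g^-1)%g = word_length A g.
Proof.
have le h : word_length A (h^-1)%g <= word_length A h.
  have [[w [Aw wh] <-] _] := word_lengthP h; rewrite -size_inv_word.
  by apply: word_length_le; split; [exact: is_word_inv|rewrite word_eval_inv wh].
by apply/eqP; rewrite eqn_leq le -{1}[g]invgK le.
Qed.

Lemma word_length_gen s : A s -> word_length A s <= 1.
Proof.
move=> As; apply: (@word_length_le _ [:: s]).
by split; [apply: is_word_cons|rewrite word_eval_cons word_eval_nil mulg1].
Qed.

Lemma word_length_le1 g : word_length A g <= 1 -> g = 1%g \/ A g.
Proof.
have [[w [Aw <-] <-] _] := word_lengthP g; case: w Aw => [|s [|//]] Aw _.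
  by left; rewrite word_eval_nil.
right; rewrite word_eval_cons word_eval_nil mulg1.
by have [] := is_word_cons_inv Aw.
Qed.

Local Notation d := (word_dist A).

Lemma word_distM h x y : d (h * x)%g (h * y)%g = d x y.
Proof. by rewrite /word_dist invgM mulgA mulgVK. Qed.

Lemma word_dist1 g : d 1%g g = word_length A g.
Proof. by rewrite /word_dist invg1 mul1g. Qed.

Lemma word_dist_mulr x g : d x (x * g)%g = word_length A g.
Proof. by rewrite /word_dist mulKg. Qed.

Lemma word_dist_metric : is_metric d.
Proof.
split=> [x|x y|x y z]; rewrite /word_dist.
- by rewrite mulVg word_length1.
- by rewrite -word_lengthV invgM invgK.
- by have := word_lengthM (x^-1 * y) (y^-1 * z); rewrite mulgA mulgK.
Qed.

Lemma word_dist_take w x : is_word A w -> forall i j, i <= j -> j <= size w ->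
  d (x * word_eval (take i w))%g (x * word_eval (take j w))%g <= j - i.
Proof.
move=> Aw i j leij lej.
have -> : take j w = take i w ++ take (j - i) (drop i w).
  by rewrite take_drop subnK // -{1}(cat_take_drop i (take j w)) take_takel.
rewrite word_eval_cat mulgA word_dist_mulr.
have sz : size (take (j - i) (drop i w)) = j - i.
  by rewrite size_take size_drop; case: ltnP => //; lia.
rewrite -{2}sz; apply: word_length_le; split=> // s /mem_take/mem_drop; exact: Aw.
Qed.

(** A path moving by at most 1 per letter whose ends are [size w] apart is isometric. *)
Lemma geodesic_geod w x : geodesic A w ->
  geod d (fun i => x * word_eval (take i w))%g (size w).
Proof.
move=> [Aw wl] i j leij lej; have [_ _ dT] := word_dist_metric.
have := word_dist_take x Aw leij lej.
have := word_dist_take x Aw (leq0n i) (leq_trans leij lej).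
have := word_dist_take x Aw lej (leqnn _).
have : d (x * word_eval (take 0 w))%g (x * word_eval (take (size w) w))%g = size w.
  by rewrite take0 word_eval_nil mulg1 word_dist_mulr take_size.
set a := (x * _)%g; set b := (x * word_eval (take (size w) w))%g.
set u := (x * word_eval (take i w))%g; set v := (x * word_eval (take j w))%g.
have := dT a u b; have := dT u v b; lia.
Qed.

Lemma word_dist_geodesic_space : geodesic_space d.
Proof.
move=> x y; have [[w [Aw wl] sw] _] := word_lengthP (x^-1 * y)%g.
have gw : geodesic A w by split=> //; rewrite wl.
exists (fun i => x * word_eval (take i w))%g; split.
- by have := geodesic_geod x gw; rewrite sw.
- by rewrite take0 word_eval_nil mulg1.
- by rewrite /word_dist -sw take_size wl mulVKg.
Qed.

Lemma geod_geodesic c n : geod d c n ->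
  exists w, [/\ geodesic A w, size w = n
    & forall i, i <= n -> c i = (c 0 * word_eval (take i w))%g].
Proof.
move=> gc; pose w := [seq ((c i)^-1 * c i.+1)%g | i <- iota 0 n].
have sw : size w = n by rewrite size_map size_iota.
have ev i : i <= n -> c i = (c 0 * word_eval (take i w))%g.
  elim: i => [|i IHi] lti; first by rewrite take0 word_eval_nil mulg1.
  rewrite (take_nth 1%g) ?sw // -cats1 word_eval_cat mulgA -IHi; last exact: ltnW.
  rewrite (nth_map 0) ?size_iota // nth_iota // add0n word_eval_cons word_eval_nil.
  by rewrite mulg1 mulVKg.
exists w; split=> //; split.
  move=> s /mapP[i]; rewrite mem_iota /= add0n => lti ->.
  have := gc i i.+1 (leqnSn i) lti; rewrite subSnn => di.
  have [e|//] := word_length_le1 (eq_leq di).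
  by rewrite /word_dist e word_length1 in di.
have := gc 0 n (leq0n n) (leqnn n); rewrite subn0 (ev n) // -sw take_size.
by rewrite word_dist_mulr.
Qed.

(** [adj] includes equality; stationary steps give no letter, so [w] may be shorter than [n]. *)
Lemma conn_word P n x y : conn (adj d) P n x y ->
  exists w, [/\ is_word A w, size w <= n, (x * word_eval w)%g = y
    & forall i, i <= size w -> P (x * word_eval (take i w))%g].
Proof.
elim=> {n x y} [n x Px|n x y z Px adjxy _ [w [Aw sw wz Pw]]].
  exists [::]; split=> //; first by rewrite word_eval_nil mulg1.
  by move=> i _; rewrite word_eval_nil mulg1.
have [e|As] := word_length_le1 adjxy.
  have exy : x = y by rewrite -[y](mulVKg x) e mulg1.
  by exists w; rewrite exy; split=> //; lia.
exists ((x^-1 * y)%g :: w); split=> //.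
- exact: is_word_cons.
- by rewrite word_eval_cons mulgA mulVKg.
- move=> [|i] lti /=; first by rewrite word_eval_nil mulg1.
  by rewrite word_eval_cons mulgA mulVKg; apply: Pw.
Qed.

Lemma word_conn P w x : is_word A w ->
  (forall i, i <= size w -> P (x * word_eval (take i w))%g) ->
  conn (adj d) P (size w) x (x * word_eval w)%g.
Proof.
elim: w x => [|s w IHw] x Aw Pw.
  by rewrite word_eval_nil mulg1; apply: conn_refl; have := Pw 0 (leq0n _);
    rewrite word_eval_nil mulg1.
have [As Aw'] := is_word_cons_inv Aw.
apply: (@conn_step _ _ _ _ _ (x * s)%g).
- by have := Pw 0 (leq0n _); rewrite word_eval_nil mulg1.
- by rewrite /adj word_dist_mulr word_length_gen.
- rewrite word_eval_cons mulgA; apply: IHw => // i lei.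
  by have := Pw i.+1 lei; rewrite /= word_eval_cons mulgA.
Qed.

Hypothesis Afin : finite_set A.

Lemma ball_seq n : exists E : seq G, uniq E /\ forall g, (g \in E) = (word_length A g <= n).
Proof.
have [S SE] : exists S : seq G, A = [set` S] by apply/finite_seqP.
suff [E EP] : exists E : seq G, forall g, word_length A g <= n -> g \in E.
  exists (undup [seq g <- E | word_length A g <= n]); split; first exact: undup_uniq.
  by move=> g; rewrite mem_undup mem_filter; case: leqP => //= /EP.
elim: n => [|n [E EP]].
  exists [:: 1%g] => g; have [[w [Aw <-] <-] _] := word_lengthP g.
  by rewrite leqn0 size_eq0 => /eqP ->; rewrite word_eval_nil mem_head.
exists (1%g :: [seq (s * g)%g | s <- S, g <- E]) => g.
have [[w [Aw <-] <-] _] := word_lengthP g.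
case: w Aw => [|s w] Aw; first by rewrite word_eval_nil mem_head.
move=> /= lew; have [As Aw'] := is_word_cons_inv Aw.
rewrite word_eval_cons inE allpairs_f ?orbT //; first by move: As; rewrite SE.
by apply: EP; apply: (@leq_trans (size w)) => //; apply: word_length_le.
Qed.

End WordEval.

Lemma word_length_lipschitz (G : groupType) (A A' : set G) :
  symmetric_set A -> generates A -> finite_set A' ->
  exists c, forall w, is_word A' w -> word_length A (word_eval w) <= c * size w.
Proof.
move=> Asym Agen /finite_seqP[S' ->]; exists (\sum_(s <- S') word_length A s) => w.
elim: w => [_|s w IHw Sw]; first by rewrite word_eval_nil word_length1.
have [sS /IHw le] := is_word_cons_inv Sw; rewrite word_eval_cons mulnS.
apply: leq_trans (word_lengthM Asym Agen _ _) (leq_add _ le).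
by rewrite (big_rem s) //= leq_addr.
Qed.

(** * Branching in hyperbolic groups *)

Lemma size_fibers (T : eqType) (E : seq T) (f : T -> nat) r M :
  (forall v, v \in E -> f v <= r) ->
  (forall i, count (fun v => f v == i) E <= M) -> size E <= r.+1 * M.
Proof.
move=> fr fM; have -> : size E = count (fun v => f v <= r) E.
  by apply/esym/eqP; rewrite -all_count; apply/allP.
elim: r {fr} => [|r IHr].
  by rewrite mul1n; apply: leq_trans (fM 0); apply: sub_count => v /=; rewrite leqn0.
apply: (@leq_trans (count (fun v => f v <= r) E + count (fun v => f v == r.+1) E)).
  rewrite -count_predUI; apply: leq_trans (leq_addr _ _); apply: sub_count => v /=.
  by rewrite leq_eqVlt ltnS orbC.
by rewrite mulSn addnC leq_add.
Qed.

Section Branching.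
Variables (G : groupType) (A : set G) (D : nat).
Hypotheses (Asym : symmetric_set A) (Agen : generates A) (Afin : finite_set A).
Hypothesis dH : hyp4 (word_dist A) D.
Local Notation d := (word_dist A).
Local Notation len := (word_length A).
Let dM : is_metric d := word_dist_metric Asym Agen.
Let d0 x : d x x = 0. Proof. by case: dM. Qed.
Let dC x y : d x y = d y x. Proof. by case: dM. Qed.
Let dT x y z : d x z <= d x y + d y z. Proof. by case: dM. Qed.

Lemma ball_size r : exists2 M, 0 < M & forall v (E : seq G), uniq E ->
  (forall w, w \in E -> d v w <= r) -> size E <= M.
Proof.
have [B [_ BP]] := ball_seq Asym Agen Afin r.
exists (size B).+1 => // v E uE Er; apply: leqW.
rewrite -(size_map (fun w => v^-1 * w)%g); apply: uniq_leq_size.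
  by rewrite map_inj_uniq //; apply: mulgI.
by move=> _ /mapP[w /Er dw ->]; rewrite BP.
Qed.

Definition unbounded_spheres := forall N, exists n (E : seq G),
  [/\ uniq E, N <= size E & forall g, g \in E -> len g = n].

(* Gromov products are doubled throughout. *)
Lemma tripod : unbounded_spheres -> exists c b0 b1 b2,
  [/\ len b0 + len b1 <= d b0 b1 + c, len b0 + len b2 <= d b0 b2 + c
    & len b1 + len b2 <= d b1 b2 + c] /\
  [/\ 2 * c + 5 * D < 2 * len b0, 2 * c + 5 * D < 2 * len b1
    & 2 * c + 5 * D < 2 * len b2].
Proof.
move=> unb; pose K := 7 * D + 5.
have [M M_gt0 MP] := ball_size (2 * K).
have [M' _ M'P] := ball_size (2 * K + 5 * D).
(* More than [2 * M] points leave one far from two given points; more than [M'] points do not fit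
   into a small ball, so [n] is large. *)
have [n [E [uE leE En]]] := unb (2 * M + M' + 3).
have far (F : seq G) a1 a2 : uniq F -> 2 * M < size F ->
    exists a3, [/\ a3 \in F, 2 * K < d a1 a3 & 2 * K < d a2 a3].
  move=> uF ltF; case: (boolP (has (fun a => (2 * K < d a1 a) && (2 * K < d a2 a)) F)).
    by case/hasP=> a aF /andP[? ?]; exists a.
  move/hasPn=> near; exfalso.
  have := MP a1 [seq a <- F | d a1 a <= 2 * K] (filter_uniq _ uF).
  have := MP a2 [seq a <- F | d a2 a <= 2 * K] (filter_uniq _ uF).
  have fP a : forall w, w \in [seq v <- F | d a v <= 2 * K] -> d a w <= 2 * K.
    by move=> w; rewrite mem_filter => /andP[].
  move=> /(_ (fP a2)) + /(_ (fP a1)); rewrite !size_filter.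
  have : size F <= count (fun a => d a1 a <= 2 * K) F + count (fun a => d a2 a <= 2 * K) F.
    rewrite -count_predUI; apply: leq_trans (leq_addr _ _).
    rewrite (eq_in_count (a2 := predT)) ?count_predT // => a /near /=.
    by rewrite negb_and -!leqNgt.
  move=> h1 h2 h3; move: ltF; rewrite ltnNge => /negP; apply.
  by apply: leq_trans h1 _; rewrite (mul2n M) -(addnn M); apply: leq_add.
have n_gt : 2 * K + 5 * D < n.
  rewrite ltnNge; apply/negP => le; have := M'P 1%g E uE.
  have H : forall w, w \in E -> d 1%g w <= 2 * K + 5 * D.
    by move=> w /En lw; rewrite word_dist1 lw.
  by move=> /(_ H); lia.
case: E uE leE En => [|a1 E uE leE En]; first by rewrite addn3.
have [a2 [a2E _ d12]] := far (a1 :: E) a1 a1 uE ltac:(lia).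
have [a3 [a3E d13 d23]] := far (a1 :: E) a1 a2 uE ltac:(lia).
have [l1 l2 l3] : [/\ len a1 = n, len a2 = n & len a3 = n].
  by rewrite !En ?mem_head.
(* If [a] and [a'] have a large Gromov product, the tripod consists of the legs from the branch
   point [p] to the origin, [a] and [a'], translated by [p^-1]. *)
have cut a a' : len a = n -> len a' = n -> 2 * K < d a a' -> d a a' + 2 * K <= 2 * n ->
    exists c b0 b1 b2, [/\ len b0 + len b1 <= d b0 b1 + c, len b0 + len b2 <= d b0 b2 + c
    & len b1 + len b2 <= d b1 b2 + c] /\ [/\ 2 * c + 5 * D < 2 * len b0,
    2 * c + 5 * D < 2 * len b1 & 2 * c + 5 * D < 2 * len b2].
  move=> la la' lt le; have [g [gg g0 gn]] := word_dist_geodesic_space Asym Agen 1%g a.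
  rewrite word_dist1 la in gg gn.
  have [k [k1 k2]] : exists k, 2 * k + d a a' <= 2 * n /\ 2 * n <= 2 * k + d a a' + 1.
    by exists ((2 * n - d a a') %/ 2); lia.
  pose p := g k.
  have dp1 : d p 1%g = k by rewrite dC -g0 gg // ?subn0 //; lia.
  have dpa : d p a = n - k by rewrite -gn gg //; lia.
  have := dT 1%g p a'; have := dT a p a'; have := dH 1%g a p a'.
  have := dH p a 1%g a'; have := dH a' 1%g p a.
  have dE x y : d (p^-1 * x)%g (p^-1 * y)%g = d x y by rewrite word_distM.
  have lE x : len (p^-1 * x)%g = d p x by [].
  rewrite (dC 1%g p) (dC a p) dp1 dpa !word_dist1 la la' (dC a' a) (dC a' 1%g) (dC a' p).
  rewrite (dC a 1%g) !word_dist1 la la' => h1 h2 h3 h4 h5.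
  exists (D + 2), (p^-1 * 1)%g, (p^-1 * a)%g, (p^-1 * a')%g.
  by rewrite !dE !lE dp1 dpa !word_dist1 la la'; rewrite /K in lt le; split; split; lia.
case: (leqP (d a1 a2 + 2 * K) (2 * n)) => [le|lt12]; first exact: (cut a1 a2).
case: (leqP (d a1 a3 + 2 * K) (2 * n)) => [le|lt13]; first exact: (cut a1 a3).
case: (leqP (d a2 a3 + 2 * K) (2 * n)) => [le|lt23]; first exact: (cut a2 a3).
(* Now all three products are small and the points themselves will do. *)
by exists (2 * K), a1, a2, a3; rewrite l1 l2 l3; split; split; lia.
Qed.

(** * Descendants along the legs of a tripod *)

Section Children.
Variables (c : nat) (b0 b1 b2 : G).
Hypotheses (b01 : len b0 + len b1 <= d b0 b1 + c)
  (b02 : len b0 + len b2 <= d b0 b2 + c) (b12 : len b1 + len b2 <= d b1 b2 + c)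
  (lb0 : 2 * c + 5 * D < 2 * len b0) (lb1 : 2 * c + 5 * D < 2 * len b1)
  (lb2 : 2 * c + 5 * D < 2 * len b2).

(** The doubled Gromov product at [v] of the origin and [v * b] is at most [c + D]. *)
Definition outward v b := d v 1%g + d v (v * b)%g <= d 1%g (v * b)%g + c + D.

Fixpoint descendants k v : seq G :=
  if k is k'.+1 then
    flatten [seq descendants k' (v * b)%g | b <- [seq b <- [:: b0; b1; b2] | outward v b]]
  else [:: v].

(** Two legs both pointing back to the origin would have a large Gromov product with each other. *)
Lemma outward_or v b b' : len b + len b' <= d b b' + c -> outward v b || outward v b'.
Proof.
move=> bb'; have dbb : d (v * b)%g (v * b')%g = d b b' by rewrite word_distM.
have := dH v (v * b)%g 1%g (v * b')%g; rewrite /outward dbb !word_dist_mulr.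
rewrite (dC (v * b)%g 1%g) => h; lia.
Qed.

(** As the leg is long, the four-point condition at [v * b] and then at [v] returns the same
    constant [c + 2 * D], so the error does not grow over the generations. *)
Lemma outward_step v b w : 2 * c + 5 * D < 2 * len b -> outward v b ->
  d (v * b)%g 1%g + d (v * b)%g w <= d 1%g w + c + 2 * D ->
  d v 1%g + d v w <= d 1%g w + c + 2 * D /\ len b + d (v * b)%g w <= d v w + c + 3 * D.
Proof.
rewrite /outward word_dist_mulr => lb out fw.
have := dH (v * b)%g 1%g v w; have := dH v 1%g w (v * b)%g.
rewrite (dC (v * b)%g v) !word_dist_mulr (dC (v * b)%g 1%g) in fw *.
rewrite (dC 1%g v) (dC w (v * b)%g) => h1 h2; lia.
Qed.

Lemma descendants_step k v w : w \in descendants k.+1 v ->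
  exists b, [/\ b \in [:: b0; b1; b2], outward v b & w \in descendants k (v * b)%g].
Proof.
move=> /flatten_mapP[b]; rewrite mem_filter => /andP[out bb] wk.
by exists b.
Qed.

Lemma tripod_len b : b \in [:: b0; b1; b2] -> 2 * c + 5 * D < 2 * len b.
Proof. by rewrite !inE => /or3P[] /eqP ->. Qed.

Lemma descendants_far k v w : w \in descendants k v ->
  d v 1%g + d v w <= d 1%g w + c + 2 * D.
Proof.
elim: k v => [|k IHk] v; first by rewrite inE => /eqP ->; rewrite d0 dC; lia.
move=> /descendants_step[b [bb out /IHk fw]].
by have [] := outward_step (tripod_len bb) out fw.
Qed.

Lemma descendants_dist k v w : w \in descendants k v ->
  d v w <= k * (len b0 + len b1 + len b2).
Proof.
elim: k v => [|k IHk] v; first by rewrite inE => /eqP ->; rewrite d0.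
move=> /descendants_step[b [bb _ /IHk dw]].
have := dT v (v * b)%g w; rewrite word_dist_mulr.
have : len b <= len b0 + len b1 + len b2 by move: bb; rewrite !inE => /or3P[] /eqP ->; lia.
lia.
Qed.

(** A common descendant [w] would have [v * b] and [v * b'] both almost on geodesics from [v] to
    [w], against the small Gromov product of [b] and [b']. *)
Lemma descendants_disjoint k v b b' : b \in [:: b0; b1; b2] -> b' \in [:: b0; b1; b2] ->
  len b + len b' <= d b b' + c -> outward v b -> outward v b' ->
  ~~ has (mem (descendants k (v * b)%g)) (descendants k (v * b')%g).
Proof.
move=> bb bb' dbb out out'; apply/hasPn => w /descendants_far fw'.
apply/negP => /= /descendants_far fw.
have [_ h1] := outward_step (tripod_len bb) out fw.
have [_ h2] := outward_step (tripod_len bb') out' fw'.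
have dE : d (v * b)%g (v * b')%g = d b b' by rewrite word_distM.
have := dH v (v * b)%g w (v * b')%g; rewrite dE !word_dist_mulr (dC w (v * b')%g).
have := tripod_len bb; have := tripod_len bb'; lia.
Qed.

Lemma descendants_uniq k v : uniq (descendants k v).
Proof.
elim: k v => [|k IHk] v //=.
have dis := @descendants_disjoint k v.
have b0P : b0 \in [:: b0; b1; b2] by rewrite !inE eqxx.
have b1P : b1 \in [:: b0; b1; b2] by rewrite !inE eqxx orbT.
have b2P : b2 \in [:: b0; b1; b2] by rewrite !inE eqxx !orbT.
case E0: (outward v b0); case E1: (outward v b1); case E2: (outward v b2);
  rewrite /= ?cats0 ?cat_uniq ?has_cat ?negb_or ?IHk ?(dis b0 b1) ?(dis b0 b2) ?(dis b1 b2) //.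
Qed.

(** By [outward_or], at most one of the three legs at a vertex is not outward. *)
Lemma descendants_size k v : 2 ^ k <= size (descendants k v).
Proof.
elim: k v => [|k IHk] v //=.
have := outward_or v b01; have := outward_or v b02; have := outward_or v b12.
have := IHk (v * b0)%g; have := IHk (v * b1)%g; have := IHk (v * b2)%g.
rewrite expnS; case E0: (outward v b0); case E1: (outward v b1); case E2: (outward v b2) => //=;
  rewrite ?size_cat; lia.
Qed.

End Children.

(* The number of parents of a point grows linearly in the number of
   generations, as parents at a given distance lie in a ball of fixed radius;
   the number of children grows exponentially. *)
Lemma branching : unbounded_spheres -> exists M r (chl : G -> seq G),
  [/\ 0 < M, forall v, uniq (chl v) /\ 4 * M <= size (chl v),
      forall v w, w \in chl v -> d v w <= r
    & forall w (E : seq G), uniq E -> (forall v, v \in E -> w \in chl v) -> size E <= M].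
Proof.
move=> /tripod[c [b0 [b1 [b2 [[b01 b02 b12] [lb0 lb1 lb2]]]]]].
have [B B_gt0 BP] := ball_size (c + 3 * D).
set L := len b0 + len b1 + len b2.
have [k0 kP] := linear_le_expn (4 * B * L) (4 * B).
exists ((k0 * L).+1 * B), (k0 * L), (descendants c b0 b1 b2 k0); split.
- by rewrite muln_gt0.
- move=> v; split; first exact: descendants_uniq.
  have := descendants_size b01 b02 b12 lb0 lb1 lb2 k0 v; have := kP k0 (leqnn _) => h1.
  by apply: leq_trans; apply: leq_trans h1; lia.
- by move=> v w; apply: descendants_dist.
- move=> w E uE Ew; apply: (size_fibers (f := fun v => d v w)).
    by move=> v /Ew; apply: descendants_dist.
  move=> i; rewrite -size_filter.
  case EF: [seq v <- E | d v w == i] => [//|v F].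
  rewrite -EF; apply: (BP v); first exact: filter_uniq.
  (* Both [u] and [v] are at distance [i] from [w] and almost on geodesics from [w] to the origin,
     hence close. *)
  move=> u; rewrite mem_filter => /andP[/eqP du uE'].
  have : v \in [seq v <- E | d v w == i] by rewrite EF mem_head.
  rewrite mem_filter => /andP[/eqP dv vE].
  have fu := descendants_far b01 b02 b12 lb0 lb1 lb2 (Ew _ uE').
  have fv := descendants_far b01 b02 b12 lb0 lb1 lb2 (Ew _ vE).
  have := dH w u 1%g v; rewrite (dC w u) (dC w v) (dC u v) (dC w 1%g) (dC 1%g v); lia.
Qed.

End Branching.

Local Open Scope ring_scope.

(** * Random walks *)

Section FiniteSupport.
Variables (R : realType) (G : groupType).
Implicit Types (f g : G -> R) (E : seq G).

Definition fin_supp f := exists E, forall x, f x != 0 -> x \in E.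

Definition gsum f : R := \sum_(x \in setT) f x.

Lemma gsum_seq f E : uniq E -> (forall x, f x != 0 -> x \in E) ->
  gsum f = \sum_(x <- E) f x.
Proof.
move=> uE fE; rewrite fsbig_seq // /gsum; apply/esym/fsbig_widen => // x [_ /= xE].
by apply/eqP; apply: contraT => /fE.
Qed.

Lemma fin_supp_uniq f : fin_supp f -> exists2 E, uniq E & forall x, f x != 0 -> x \in E.
Proof.
by move=> [E fE]; exists (undup E) => [|x /fE]; rewrite ?undup_uniq ?mem_undup.
Qed.

Lemma fin_supp2 f g : fin_supp f -> fin_supp g -> exists E,
  [/\ uniq E, forall x, f x != 0 -> x \in E & forall x, g x != 0 -> x \in E].
Proof.
move=> [E fE] [F gF]; exists (undup (E ++ F)); split; first exact: undup_uniq.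
  by move=> x /fE xE; rewrite mem_undup mem_cat xE.
by move=> x /gF xF; rewrite mem_undup mem_cat xF orbT.
Qed.

Lemma fin_supp_sub f g : fin_supp f -> (forall x, f x = 0 -> g x = 0) -> fin_supp g.
Proof.
move=> [E fE] fg; exists E => x gx; apply: fE; apply: contraNneq gx => fx.
by rewrite fg.
Qed.

Lemma fin_suppD f g : fin_supp f -> fin_supp g -> fin_supp (fun x => f x + g x).
Proof.
move=> ff fg; have [E [_ fE gE]] := fin_supp2 ff fg; exists E => x.
case: (eqVneq (f x) 0) => [->|/fE //]; rewrite add0r; exact: gE.
Qed.

Lemma fin_suppZ a f : fin_supp f -> fin_supp (fun x => a * f x).
Proof. by move=> ff; apply: (fin_supp_sub ff) => x ->; rewrite mulr0. Qed.

Lemma fin_suppMl f g : fin_supp f -> fin_supp (fun x => f x * g x).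
Proof. by move=> ff; apply: (fin_supp_sub ff) => x ->; rewrite mul0r. Qed.

Lemma fin_suppN f : fin_supp f -> fin_supp (fun x => - f x).
Proof. by move=> ff; apply: (fin_supp_sub ff) => x ->; rewrite oppr0. Qed.

Lemma fin_supp_sqr f : fin_supp f -> fin_supp (fun x => f x ^+ 2).
Proof. by move=> ff; apply: (fin_supp_sub ff) => x ->; rewrite expr0n. Qed.

Lemma fin_supp_comp f h h' : cancel h h' -> fin_supp f -> fin_supp (fun x => f (h x)).
Proof.
move=> hK [E fE]; exists (map h' E) => x /fE hx.
by apply/mapP; exists (h x).
Qed.

Lemma fin_suppR a f : fin_supp f -> fin_supp (fun x => f (x * a)%g).
Proof. exact: (fin_supp_comp (mulgK a)). Qed.

Lemma fin_suppL a f : fin_supp f -> fin_supp (fun x => f (a * x)%g).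
Proof. exact: (fin_supp_comp (mulKg a)). Qed.

Lemma fin_supp_sum (I : eqType) (r : seq I) (F : I -> G -> R) :
  (forall i, i \in r -> fin_supp (F i)) -> fin_supp (fun x => \sum_(i <- r) F i x).
Proof.
elim: r => [|i r IHr] fF; first by exists [::] => x; rewrite big_nil eqxx.
have fi : fin_supp (F i) by apply: fF; rewrite mem_head.
have fr : fin_supp (fun x => \sum_(j <- r) F j x).
  by apply: IHr => j jr; apply: fF; rewrite inE jr orbT.
by apply: (fin_supp_sub (fin_suppD fi fr)) => x; rewrite big_cons.
Qed.

Lemma eq_gsum f g : f =1 g -> gsum f = gsum g.
Proof. by move=> /funext ->. Qed.

Lemma gsumD f g : fin_supp f -> fin_supp g ->
  gsum (fun x => f x + g x) = gsum f + gsum g.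
Proof.
move=> ff fg; have [E [uE fE gE]] := fin_supp2 ff fg.
rewrite (gsum_seq uE fE) (gsum_seq uE gE) -big_split; apply: gsum_seq => // x.
case: (eqVneq (f x) 0) => [->|/fE //]; rewrite add0r; exact: gE.
Qed.

Lemma gsumZ a f : fin_supp f -> gsum (fun x => a * f x) = a * gsum f.
Proof.
move=> /fin_supp_uniq[E uE fE]; rewrite (gsum_seq uE fE) mulr_sumr.
apply: gsum_seq => // x; case: (eqVneq (f x) 0) => [->|/fE //].
by rewrite mulr0 eqxx.
Qed.

Lemma le_gsum f g : fin_supp f -> fin_supp g -> (forall x, f x <= g x) ->
  gsum f <= gsum g.
Proof.
move=> ff fg le; have [E [uE fE gE]] := fin_supp2 ff fg.
by rewrite (gsum_seq uE fE) (gsum_seq uE gE); apply: ler_sum.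
Qed.

Lemma gsum_ge0 f : (forall x, 0 <= f x) -> 0 <= gsum f.
Proof. by move=> f0; rewrite /gsum fsumr_ge0. Qed.

Lemma sum_le_gsum f E : fin_supp f -> (forall x, 0 <= f x) -> uniq E ->
  \sum_(x <- E) f x <= gsum f.
Proof.
move=> ff f0 uE.
have -> : \sum_(x <- E) f x = gsum (fun x => (x \in E)%:R * f x).
  rewrite (gsum_seq uE); last by move=> x; case: (x \in E) => //; rewrite mul0r eqxx.
  by rewrite big_seq [RHS]big_seq; apply: eq_bigr => x ->; rewrite mul1r.
apply: le_gsum => // [|x].
  by apply: (fin_supp_sub ff) => x ->; rewrite mulr0.
by case: (x \in E); rewrite ?mul1r // mul0r.
Qed.

Lemma gsumR a f : gsum (fun x => f (x * a)%g) = gsum f.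
Proof.
rewrite /gsum [RHS](reindex_fsbigT (fun x => (x * a)%g)) //.
by exists (fun x => (x * a^-1)%g) => x; rewrite ?mulgK ?mulgVK.
Qed.

Lemma gsumL a f : gsum (fun x => f (a * x)%g) = gsum f.
Proof.
rewrite /gsum [RHS](reindex_fsbigT (fun x => (a * x)%g)) //.
by exists (fun x => (a^-1 * x)%g) => x; rewrite ?mulKg ?mulVKg.
Qed.

Lemma gsum_sum (I : eqType) (r : seq I) (F : I -> G -> R) :
  (forall i, i \in r -> fin_supp (F i)) ->
  gsum (fun x => \sum_(i <- r) F i x) = \sum_(i <- r) gsum (F i).
Proof.
elim: r => [|i r IHr] fF.
  by rewrite big_nil (@gsum_seq _ [::]) ?big_nil // => x; rewrite big_nil eqxx.
rewrite big_cons -IHr; last by move=> j jr; apply: fF; rewrite inE jr orbT.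
rewrite -gsumD; first by apply: eq_gsum => x; rewrite big_cons.
  by apply: fF; rewrite mem_head.
by apply: fin_supp_sum => j jr; apply: fF; rewrite inE jr orbT.
Qed.

Definition ip f g := gsum (fun x => f x * g x).

Definition energy a f := gsum (fun x => (f x - f (x * a)%g) ^+ 2).

Lemma energyE a f : fin_supp f -> energy a f = 2 * ip f f - 2 * ip f (fun x => f (x * a)%g).
Proof.
move=> ff; rewrite /energy.
have -> : ip f f = gsum (fun x => f (x * a)%g * f (x * a)%g).
  by rewrite (gsumR a (fun x => f x * f x)).
have -> : gsum (fun x => (f x - f (x * a)%g) ^+ 2) = gsum (fun x => f x * f x) +
    (gsum (fun x => f (x * a)%g * f (x * a)%g) + gsum (fun x => -2 * (f x * f (x * a)%g))).
  have h1 : fin_supp (fun x => f x * f x) by apply: fin_suppMl.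
  have h2 : fin_supp (fun x => f (x * a)%g * f (x * a)%g) := fin_suppMl _ (fin_suppR a ff).
  have h3 : fin_supp (fun x => -2 * (f x * f (x * a)%g)) by apply/fin_suppZ/fin_suppMl.
  by rewrite -gsumD // -gsumD //; [apply: eq_gsum => x; ring|apply: fin_suppD].
rewrite gsumZ; last exact: fin_suppMl.
rewrite (gsumR a (fun x => f x * f x)) /ip; ring.
Qed.

Lemma fin_supp_diff a f : fin_supp f -> fin_supp (fun x => (f x - f (x * a)%g) ^+ 2).
Proof.
move=> ff; apply/fin_supp_sqr/fin_suppD => //; apply: fin_suppN; exact: fin_suppR.
Qed.

Lemma energy_ge0 a f : 0 <= energy a f.
Proof. by apply: gsum_ge0 => x; apply: sqr_ge0. Qed.

Lemma energyM a b f : fin_supp f -> energy (a * b)%g f <= 2 * energy a f + 2 * energy b f.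
Proof.
move=> ff; have fa := fin_supp_diff a ff; have fb := fin_supp_diff b ff.
have ha := fin_suppZ 2 fa; have hb := fin_suppZ 2 (fin_suppR a fb).
rewrite -[energy b f](gsumR a) /energy -(gsumZ 2 fa) -(gsumZ 2 (fin_suppR a fb)).
rewrite -gsumD //; apply: le_gsum => [||x].
- exact: fin_supp_diff.
- exact: fin_suppD.
rewrite mulgA; set u := f x; set v := f _; set w := f _.
have := sqr_ge0 (u - 2 * w + v); rewrite !expr2; lra.
Qed.

Lemma energy1 f : energy 1%g f = 0.
Proof.
rewrite /energy (@gsum_seq _ [::]) ?big_nil // => x.
by rewrite mulg1 subrr expr0n eqxx.
Qed.

End FiniteSupport.

Lemma ler_sum_subset (R : realType) (T : eqType) (F : T -> R) (s s' : seq T) :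
  (forall x, 0 <= F x) -> uniq s -> {subset s <= s'} ->
  \sum_(x <- s) F x <= \sum_(x <- s') F x.
Proof.
move=> F0; elim: s s' => [|x s IHs] s' /=; first by move=> _ _; rewrite big_nil sumr_ge0.
move=> /andP[xs us] sub; have xs' : x \in s' by apply: sub; rewrite mem_head.
rewrite (perm_big _ (perm_to_rem xs')) !big_cons lerD2l; apply: IHs => // y ys.
have : y \in s' by apply: sub; rewrite inE ys orbT.
rewrite (perm_mem (perm_to_rem xs')) inE => /orP[/eqP yx|//].
by rewrite -yx ys in xs.
Qed.

(** * The Markov operator and return probabilities *)

Section Walk.
Variables (R : realType) (G : groupType) (mu : G -> R) (S : seq G).
Hypotheses (S_uniq : uniq S) (mu_gt0 : forall s, s \in S -> 0 < mu s)
  (muV : forall s, mu s = mu (s^-1)%g) (SV : forall s, s \in S -> (s^-1)%g \in S)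
  (mu_sum : \sum_(s <- S) mu s = 1).

Definition markov (f : G -> R) v := \sum_(s <- S) mu s * f (v * s)%g.

(* The n-step transition probability from v to the neutral element. *)
Definition hit n : G -> R := iter n markov (fun v => (v == 1%g)%:R).

Definition return_prob n := hit n 1%g.

Local Notation ret := return_prob.

Definition dirichlet f := \sum_(s <- S) mu s * energy s f.

Lemma hitS n v : hit n.+1 v = \sum_(s <- S) mu s * hit n (v * s)%g.
Proof. by []. Qed.

Lemma mu_ge0 s : s \in S -> 0 <= mu s.
Proof. by move/mu_gt0/ltW. Qed.

Lemma hit_ge0 n v : 0 <= hit n v.
Proof.
elim: n v => [|n IHn] v; first by rewrite /hit /= ler0n.
by rewrite hitS big_seq; apply: sumr_ge0 => s /mu_ge0 ms; apply: mulr_ge0.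
Qed.

Lemma hit_le1 n v : hit n v <= 1.
Proof.
elim: n v => [|n IHn] v; first by rewrite /hit /=; case: (v == _).
rewrite hitS -mu_sum big_seq [leRHS]big_seq; apply: ler_sum => s /mu_ge0 ms.
by rewrite -[leRHS]mulr1; apply: ler_wpM2l.
Qed.

Lemma fin_supp_markov f : fin_supp f -> fin_supp (markov f).
Proof. by move=> ff; apply: fin_supp_sum => s _; apply/fin_suppZ/fin_suppR. Qed.

Lemma fin_supp_hit n : fin_supp (hit n).
Proof.
elim: n => [|n IHn]; last exact: fin_supp_markov.
exists [:: 1%g] => x; rewrite /hit /= inE; by case: (x == 1%g) => //; rewrite eqxx.
Qed.

(** Self-adjointness from the symmetry of [mu]: translate by [s] and exchange [s] with its
    inverse. *)
Lemma ip_markov f g : fin_supp f -> fin_supp g -> ip (markov f) g = ip f (markov g).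
Proof.
move=> ff fg; rewrite /ip /markov.
transitivity (\sum_(s <- S) mu s * gsum (fun x => f (x * s)%g * g x)).
  transitivity (gsum (fun x => \sum_(s <- S) mu s * (f (x * s)%g * g x))).
    by apply: eq_gsum => x; rewrite mulr_suml; apply: eq_bigr => s _; rewrite mulrA.
  rewrite gsum_sum => [|s _]; last exact/fin_suppZ/fin_suppMl/fin_suppR.
  by apply: eq_bigr => s _; rewrite gsumZ //; apply/fin_suppMl/fin_suppR.
transitivity (\sum_(s <- S) mu s * gsum (fun x => f x * g (x * s)%g)); last first.
  transitivity (gsum (fun x => \sum_(s <- S) mu s * (f x * g (x * s)%g))); last first.
    by apply: eq_gsum => x; rewrite mulr_sumr; apply: eq_bigr => s _; rewrite mulrCA.
  rewrite gsum_sum => [|s _]; last exact/fin_suppZ/fin_suppMl.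
  by apply: eq_bigr => s _; rewrite gsumZ //; apply/fin_suppMl.
have pV : perm_eq S [seq (s^-1)%g | s <- S].
  apply: uniq_perm => //; first by rewrite map_inj_uniq //; apply: invg_inj.
  move=> s; apply/idP/mapP => [sS|[t tS ->]]; last exact: SV.
  by exists (s^-1)%g; rewrite ?invgK //; apply: SV.
rewrite (perm_big _ pV) big_map; apply: eq_bigr => s _; rewrite -muV; congr (_ * _).
rewrite -(gsumR s); apply: eq_gsum => x; by rewrite mulgK.
Qed.

(** Self-adjointness moves the steps one at a time from the left factor to the right one. *)
Lemma ip_hit i j g : ip (hit i) (fun v => hit j (g * v)%g) = hit (i + j) g.
Proof.
elim: i j => [|i IHi] j.
  rewrite /ip (@gsum_seq _ _ _ [:: 1%g]) //.
    by rewrite big_seq1 /hit /= eqxx mul1r mulg1.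
  by move=> x; rewrite /hit /= inE; case: (x == 1%g) => //; rewrite mul0r eqxx.
rewrite -[hit i.+1]/(markov (hit i)) ip_markov.
- rewrite addSnnS -IHi /ip; apply: eq_gsum => v; congr (_ * _).
  by rewrite hitS; apply: eq_bigr => s _; rewrite mulgA.
- exact: fin_supp_hit.
- exact/fin_suppL/fin_supp_hit.
Qed.

Lemma ip_hit1 i j : ip (hit i) (hit j) = ret (i + j).
Proof. by rewrite /return_prob -ip_hit; apply: eq_gsum => v; rewrite mul1g. Qed.

(** [ip_hit] combined with the inequality between arithmetic and geometric means. *)
Lemma hit_le i j g : 2 * hit (i + j) g <= ret (i + i) + ret (j + j).
Proof.
rewrite -ip_hit -!ip_hit1.
have fi := fin_supp_hit i; have fj := fin_supp_hit j.
have fj' := fin_suppL g fj.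
have -> : ip (hit j) (hit j) = gsum (fun v => hit j (g * v)%g * hit j (g * v)%g).
  by rewrite (gsumL g (fun v => hit j v * hit j v)).
rewrite /ip -gsumZ; last exact: fin_suppMl.
rewrite -gsumD; [|exact: fin_suppMl|exact: fin_suppMl].
apply: le_gsum => [||v]; first exact/fin_suppZ/fin_suppMl.
  by apply: fin_suppD; apply: fin_suppMl.
by have := sqr_ge0 (hit i v - hit j (g * v)%g); rewrite !expr2; lra.
Qed.

Lemma weight_hit w n v : is_word [set` S] w ->
  weight mu w * hit n (v * word_eval w)%g <= hit (size w + n) v.
Proof.
elim: w v => [|s w IHw] v Sw; first by rewrite /weight big_nil mul1r word_eval_nil mulg1.
have [sS Sw'] := is_word_cons_inv Sw.
rewrite /weight big_cons -/(weight mu w) word_eval_cons addSn hitS mulgA -mulrA.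
apply: (@le_trans _ _ (\sum_(t <- [:: s]) mu t * hit (size w + n) (v * t)%g)).
  by rewrite big_seq1; apply: ler_wpM2l; [exact: mu_ge0|exact: IHw].
rewrite [leRHS](bigD1_seq s) //= big_seq1 lerDl big_seq_cond; apply: sumr_ge0 => t /andP[tS _].
by apply: mulr_ge0; [exact: mu_ge0|exact: hit_ge0].
Qed.

Lemma gsum_hit n : gsum (hit n) = 1.
Proof.
elim: n => [|n IHn].
  rewrite (@gsum_seq _ _ _ [:: 1%g]) ?big_seq1 /hit //= ?eqxx //.
  by move=> x; rewrite inE; case: (x == 1%g) => //; rewrite eqxx.
rewrite -[hit n.+1]/(markov (hit n)) /markov gsum_sum => [|s _]; last first.
  exact/fin_suppZ/fin_suppR/fin_supp_hit.
rewrite -[RHS]mu_sum; apply: eq_bigr => s _.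
rewrite gsumZ; last exact/fin_suppR/fin_supp_hit.
by rewrite gsumR IHn mulr1.
Qed.

(** Cauchy-Schwarz: a probability vector on [size E] points has squared norm at least
    [1 / size E]. *)
Lemma ret_ge n E : uniq E -> (forall v, hit n v != 0 -> v \in E) ->
  ((size E)%:R)^-1 <= ret (n + n).
Proof.
move=> uE hE; rewrite -ip_hit1 /ip (@gsum_seq _ _ _ E) //; last first.
  by move=> x; case: (eqVneq (hit n x) 0) => [->|/hE //]; rewrite mul0r eqxx.
have sE : \sum_(v <- E) hit n v = 1 by rewrite -(gsum_seq uE hE) gsum_hit.
have E_neq0 : (size E)%:R != 0 :> R.
  rewrite pnatr_eq0; apply/eqP => /size0nil E0; move: sE; rewrite E0 big_nil.
  by move/eqP; rewrite eq_sym oner_eq0.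
set m := ((size E)%:R)^-1 : R.
have sc : \sum_(v <- E) (m * m) = m.
  by rewrite big_const_seq count_predT iter_addr_0 -mulr_natr /m mulfVK.
have : 0 <= \sum_(v <- E) (hit n v - m) ^+ 2 by apply: sumr_ge0 => v _; apply: sqr_ge0.
have -> : \sum_(v <- E) (hit n v - m) ^+ 2 = \sum_(v <- E) hit n v * hit n v -
    2 * m * \sum_(v <- E) hit n v + \sum_(v <- E) (m * m).
  rewrite mulr_sumr -sumrB -big_split; by apply: eq_bigr => v _ /=; ring.
rewrite sE sc; lra.
Qed.

Lemma hit_word n v : hit n v != 0 ->
  exists w, [/\ is_word [set` S] w, size w = n & (v * word_eval w = 1)%g].
Proof.
elim: n v => [|n IHn] v.
  rewrite /hit /=; case: (v =P 1%g) => [-> _|]; last by rewrite eqxx.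
  by exists [::]; rewrite word_eval_nil mulg1.
case: (boolP (has (fun s => hit n (v * s)%g != 0) S)) => [/hasP[s sS /IHn[w [Sw sw vw]]] _|].
  exists (s :: w); split; [exact: is_word_cons|by rewrite /= sw|].
  by rewrite word_eval_cons mulgA.
move/hasPn => h0; rewrite hitS big_seq big1 ?eqxx // => s /h0; rewrite negbK => /eqP ->.
by rewrite mulr0.
Qed.

Lemma dirichletE f : fin_supp f -> dirichlet f = 2 * (ip f f - ip f (markov f)).
Proof.
move=> ff; rewrite /dirichlet.
transitivity (\sum_(s <- S) (2 * (mu s * ip f f) - 2 * (mu s * ip f (fun x => f (x * s)%g)))).
  by apply: eq_bigr => s _; rewrite energyE //; ring.
rewrite sumrB -!mulr_sumr -mulr_suml mu_sum mul1r mulrBr; congr (_ - 2 * _).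
rewrite /ip /markov -(eq_gsum (f := fun x => \sum_(s <- S) mu s * (f x * f (x * s)%g))).
  rewrite gsum_sum => [|s _]; last exact/fin_suppZ/fin_suppMl.
  by apply: eq_bigr => s _; rewrite gsumZ //; apply: fin_suppMl.
by move=> x; rewrite mulr_sumr; apply: eq_bigr => s _; rewrite mulrCA.
Qed.

Lemma dirichlet_ge0 f : 0 <= dirichlet f.
Proof.
rewrite /dirichlet big_seq; apply: sumr_ge0 => s /mu_ge0 ms.
by apply: mulr_ge0; last exact: energy_ge0.
Qed.

(** [energyM] splits off one letter at a time, and the energy along a letter [s] is at most
    [(mu s)^-1] times the Dirichlet form. *)
Lemma energy_dirichlet w : is_word [set` S] w ->
  exists2 C, 0 <= C & forall f, fin_supp f -> energy (word_eval w) f <= C * dirichlet f.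
Proof.
elim: w => [_|s w IHw Sw].
  by exists 0 => // f _; rewrite word_eval_nil energy1 mul0r.
have [sS /IHw[C C0 CP]] := is_word_cons_inv Sw; have ms := mu_gt0 sS.
exists (2 * (mu s)^-1 + 2 * C) => [|f ff].
  by apply: addr_ge0; apply: mulr_ge0 => //; rewrite invr_ge0 ltW.
rewrite word_eval_cons; apply: (le_trans (energyM _ _ ff)).
rewrite [leRHS]mulrDl -!mulrA; apply: lerD; apply: ler_wpM2l => //; last exact: CP.
rewrite mulrC ler_pdivlMr // mulrC /dirichlet (bigD1_seq s) //= lerDl big_seq_cond.
by apply: sumr_ge0 => t /andP[/mu_ge0 mt _]; apply: mulr_ge0; last exact: energy_ge0.
Qed.

Lemma energy_sum_dirichlet E : generates [set` S] ->
  exists2 C, 0 < C & forall f, fin_supp f -> \sum_(a <- E) energy a f <= C * dirichlet f.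
Proof.
move=> Sgen; elim: E => [|a E [C C0 CP]].
  by exists 1 => // f _; rewrite big_nil mul1r dirichlet_ge0.
have [w [Sw <-]] := words_to_ex (A := [set` S]) SV Sgen a.
have [C' C'0 C'P] := energy_dirichlet Sw.
exists (C' + C) => [|f ff]; first exact: ltr_wpDl.
by rewrite big_cons mulrDl lerD ?C'P ?CP.
Qed.

End Walk.

(** * An energy inequality from branching *)

Section Branching_energy.
Variables (R : realType) (G : groupType) (A : set G).
Hypotheses (Asym : symmetric_set A) (Agen : generates A) (Afin : finite_set A).
Variables (M r : nat) (chl : G -> seq G).
Hypotheses (M_gt0 : (0 < M)%N) (chl_uniq : forall v, uniq (chl v))
  (chl_size : forall v, (4 * M <= size (chl v))%N)
  (chl_near : forall v w, w \in chl v -> (word_dist A v w <= r)%N)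
  (parents : forall w (E : seq G), uniq E -> (forall v, v \in E -> w \in chl v) ->
    (size E <= M)%N).

(** Sum [f v ^+ 2 <= 2 * f w ^+ 2 + 2 * (f v - f w) ^+ 2] over all vertices [v] and children [w]. At
    least [4 * M] children per vertex against at most [M] parents leave [2 * M * ip f f], bounded by
    twice the energy. *)
Lemma branching_energy : exists B : seq G, forall f : G -> R, fin_supp f ->
  ip f f <= \sum_(a <- B) energy a f.
Proof.
have [B [B_uniq BP]] := ball_seq Asym Agen Afin r; exists B => f ff.
have [E E_uniq fE] := fin_supp_uniq ff.
have NE : ip f f = \sum_(v <- E) f v ^+ 2.
  rewrite /ip (gsum_seq E_uniq); first by apply: eq_bigr => v _; rewrite expr2.
  by move=> x; case: (eqVneq (f x) 0) => [->|/fE //]; rewrite mul0r eqxx.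
have step1 : 4 * M%:R * ip f f <=
    \sum_(v <- E) \sum_(w <- chl v) (2 * f w ^+ 2 + 2 * (f v - f w) ^+ 2).
  rewrite NE mulr_sumr; apply: ler_sum => v _.
  apply: (@le_trans _ _ (\sum_(w <- chl v) f v ^+ 2)).
    rewrite big_const_seq count_predT iter_addr_0 -[leRHS]mulr_natl.
    by apply: ler_wpM2r; [exact: sqr_ge0|rewrite -natrM ler_nat].
  apply: ler_sum => w _; have := sqr_ge0 (f v - 2 * f w); rewrite !expr2; lra.
have step2 : \sum_(v <- E) \sum_(w <- chl v) f w ^+ 2 <= M%:R * ip f f.
  have toE v : \sum_(w <- chl v) f w ^+ 2 = \sum_(w <- E) (w \in chl v)%:R * f w ^+ 2.
    rewrite -(@gsum_seq _ _ (fun w => (w \in chl v)%:R * f w ^+ 2) E) //; last first.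
      by move=> x; case: (eqVneq (f x) 0) => [->|/fE //]; rewrite expr0n mulr0 eqxx.
    rewrite (gsum_seq (chl_uniq v)); last first.
      by move=> x; case: (x \in chl v) => //; rewrite mul0r eqxx.
    by rewrite big_seq [RHS]big_seq; apply: eq_bigr => w ->; rewrite mul1r.
  rewrite (eq_bigr _ (fun v _ => toE v)) exchange_big NE mulr_sumr /=.
  apply: ler_sum => w _; rewrite -mulr_suml; apply: ler_wpM2r; first exact: sqr_ge0.
  have -> : \sum_(v <- E) (w \in chl v)%:R = (size [seq v <- E | w \in chl v])%:R :> R.
    by rewrite size_filter -sum1_count natr_sum [RHS]big_mkcond; apply: eq_bigr => v _; case: ifP.
  rewrite ler_nat; apply: (@parents w); first exact: filter_uniq.
  by move=> v; rewrite mem_filter => /andP[].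
have step3 : \sum_(v <- E) \sum_(w <- chl v) (f v - f w) ^+ 2 <= \sum_(a <- B) energy a f.
  apply: (@le_trans _ _ (\sum_(v <- E) \sum_(a <- B) (f v - f (v * a)%g) ^+ 2)).
    apply: ler_sum => v _; rewrite -(big_map (fun a => v * a)%g predT (fun w => (f v - f w) ^+ 2)).
    apply: ler_sum_subset => // [x|w /chl_near dw]; first exact: sqr_ge0.
    apply/mapP; exists (v^-1 * w)%g; last by rewrite mulVKg.
    by rewrite BP.
  rewrite exchange_big /=; apply: ler_sum => a _; apply: sum_le_gsum => // [|x].
    exact: fin_supp_diff.
  exact: sqr_ge0.
have : 4 * M%:R * ip f f <= 2 * (M%:R * ip f f) + 2 * \sum_(a <- B) energy a f.
  apply: (le_trans step1); under eq_bigr => v _ do rewrite big_split /= -!mulr_sumr.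
  rewrite big_split /= -!mulr_sumr; lra.
have ip0 : 0 <= ip f f by rewrite NE; apply: sumr_ge0 => v _; apply: sqr_ge0.
have M1 : 1 <= M%:R :> R by rewrite ler1n.
have : ip f f <= M%:R * ip f f by rewrite ler_peMl.
lra.
Qed.

End Branching_energy.

(** * Exponential decay, and recurrence for bounded spheres *)

Section Decay.
Variables (R : realType) (G : groupType) (mu : G -> R) (S : seq G).
Hypotheses (S_uniq : uniq S) (mu_gt0 : forall s, s \in S -> 0 < mu s)
  (muV : forall s, mu s = mu (s^-1)%g) (SV : forall s, s \in S -> (s^-1)%g \in S)
  (mu_sum : \sum_(s <- S) mu s = 1) (S_gen : generates [set` S]).

Local Notation ret := (return_prob mu S).
Local Notation hit := (hit mu S).

(** The inequality keeps the spectrum of the Markov operator [P] away from 1 but not from -1, so two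
    consecutive times are added. For [f = hit n + hit n.+1], [<f, (1 - P) f>] is the decrease of
    this sum from [n] to [n + 1], and [<f, f>] is at least the sum at [n]. *)
Lemma ret_decay (B : seq G) :
  (forall f : G -> R, fin_supp f -> ip f f <= \sum_(a <- B) energy a f) ->
  exists2 rho : R, 0 <= rho < 1 & forall n, ret (n + n) + ret (n + n).+1 <= 2 * rho ^+ n.
Proof.
move=> poinc; have [C0 C0_gt0 C0P] := energy_sum_dirichlet S_uniq mu_gt0 SV B S_gen.
pose C := C0 + 1; have C_gt0 : 0 < C by rewrite addr_gt0.
have ret0 n : 0 <= ret n := hit_ge0 mu_gt0 n 1%g.
have fh := fin_supp_hit mu S.
exists (1 - (2 * C)^-1).
  have h : (2 * C)^-1 <= 1 by rewrite invf_le1 ?mulr_gt0 // /C; lra.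
  by rewrite subr_ge0 h /= ltrBlDr ltrDl invr_gt0 mulr_gt0.
elim=> [|n IHn].
  by rewrite expr0 mulr1; have := hit_le1 mu_gt0 mu_sum 0 1%g;
     have := hit_le1 mu_gt0 mu_sum 1 1%g; rewrite /return_prob; lra.
pose f v := hit n v + hit n.+1 v.
have ff : fin_supp f by apply: fin_suppD.
have ipD (g h k l : G -> R) : fin_supp g -> fin_supp h ->
    ip (fun v => g v + h v) (fun v => k v + l v) = ip g k + ip g l + (ip h k + ip h l).
  move=> fg fhh; rewrite /ip -!gsumD //; try (by apply: fin_suppMl);
    try (by apply: fin_suppD; apply: fin_suppMl).
  by apply: eq_gsum => v; ring.
have mf : markov mu S f = (fun v => hit n.+1 v + hit n.+2 v).
  apply/funext => v; rewrite /markov !hitS -big_split; apply: eq_bigr => s _ /=.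
  by rewrite /f mulrDr.
have h1 := ip_hit1 S_uniq muV SV.
have e1 := ipD _ _ (hit n) (hit n.+1) (fh n) (fh n.+1).
have e2 := ipD _ _ (hit n.+1) (hit n.+2) (fh n) (fh n.+1).
have := le_trans (poinc f ff) (C0P f ff); rewrite (dirichletE mu_sum) // mf e1 e2 !h1.
rewrite !addnS !addSn.
set a := ret (n + n); set b := ret (n + n).+1; set c := ret (n + n).+2.
set e := ret (n + n).+3 => le.
have [a0 b0 c0 e0] : [/\ 0 <= a, 0 <= b, 0 <= c & 0 <= e] by split; apply: ret0.
have key : c + e <= (1 - (2 * C)^-1) * (a + b).
  rewrite mulrBl mul1r; have : (2 * C)^-1 * (a + b) <= (a + b) - (c + e).
    rewrite mulrC ler_pdivrMr ?mulr_gt0 //.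
    have : a + b <= C0 * (2 * (a + b - (c + e))) by lra.
    have : 0 <= a + b - (c + e).
      have : 0 <= (C0 * 2) * (a + b - (c + e)) by lra.
      by rewrite pmulr_rge0 // mulr_gt0.
    rewrite /C; nra.
  lra.
apply: (le_trans key); rewrite exprS mulrCA; apply: ler_wpM2l; last exact: IHn.
have h : (2 * C)^-1 <= 1 by rewrite invf_le1 ?mulr_gt0 // /C; lra.
lra.
Qed.

Lemma hit_le_ret e0 w n : 0 <= e0 -> (forall s, s \in S -> e0 <= mu s) ->
  is_word [set` S] w ->
  e0 ^+ size w * hit n (word_eval w) <= ret (size w + n).
Proof.
move=> e00 e0P Sw; have := weight_hit S_uniq mu_gt0 n 1%g Sw; rewrite mul1g.
apply: le_trans; apply: ler_wpM2r; first exact: hit_ge0.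
elim: w Sw => [|s w IHw] Sw; first by rewrite expr0 /weight big_nil.
have [sS Sw'] := is_word_cons_inv Sw; rewrite exprS /weight big_cons.
apply: ler_pM => //; [exact: exprn_ge0|exact: e0P|exact: IHw].
Qed.

(* Bounded spheres give linearly growing balls, hence 2n-step return
   probabilities at least of order 1/n. *)
Lemma recurrent_spheres (A : set G) Gam : symmetric_set A -> generates A -> finite_set A ->
  (forall N, \sum_(n < N) ret n <= Gam) -> unbounded_spheres A.
Proof.
move=> Asym Agen Afin retP; apply: contrapT => bdd.
have [N NP] : exists N, forall n (E : seq G), uniq E ->
    (forall g, g \in E -> word_length A g = n) -> (size E <= N)%N.
  apply: contrapT => unb; apply: bdd => N; apply: contrapT => nN.
  apply: unb; exists N => n E uE En; rewrite leqNgt; apply/negP => lt.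
  by apply: nN; exists n, E; split=> //; apply: ltnW.
have [c lenP] := word_length_lipschitz Asym Agen (finite_seq S).
pose K := ((c + 1) * (N + 1))%N.
(* After [n] steps the walk is in a ball with at most [(c * n + 1) * N] elements; [harmonic n] is
   [1 / (n + 1)]. *)
have retK n : (K%:R)^-1 * harmonic n <= ret (n + n).
  have [E [uE EP]] := ball_seq Asym Agen Afin (c * n).
  have hE v : hit n v != 0 -> v \in E.
    move=> /hit_word[w [Sw sw vw]]; rewrite EP -(word_lengthV Asym Agen).
    have -> : (v^-1 = word_eval w)%g by rewrite -[RHS](mulKg v) vw mulg1.
    by rewrite -sw lenP.
  apply: le_trans (ret_ge S_uniq muV SV mu_sum uE hE).
  have E_gt0 : (0 < size E)%N.
    have : 1%g \in E by rewrite EP word_length1.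
    by case: (E).
  have sE : (size E <= (c * n).+1 * N)%N.
    apply: (size_fibers (f := word_length A)) => [v|i]; first by rewrite EP.
    rewrite -size_filter; apply: (NP i); first exact: filter_uniq.
    by move=> g; rewrite mem_filter => /andP[/eqP].
  rewrite /harmonic -invfM -natrM lef_pV2 ?posrE ?ltr0n //; last first.
    by rewrite /K muln_gt0 muln_gt0 addn1 addn1.
  by rewrite ler_nat; apply: leq_trans sE _; rewrite /K; nia.
have K_gt0 : 0 < K%:R :> R by rewrite ltr0n /K muln_gt0 addn1 addn1.
apply: (@dvg_harmonic R); apply: nondecreasing_is_cvgn.
  apply/nondecreasing_seqP => n; rewrite seriesEord /= big_ord_recr /= lerDl.
  by rewrite invr_ge0 ler0n.
exists (K%:R * Gam) => _ [n _ <-]; rewrite seriesEord /=.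
rewrite -ler_pdivrMl // mulr_sumr.
apply: le_trans (retP (n + n)%N).
elim: n => [|n IHn]; first by rewrite !big_ord0.
rewrite addSn addnS !big_ord_recr /= -addrA; apply: lerD => //.
apply: le_trans (retK n) _; rewrite lerDl; exact: hit_ge0.
Qed.

End Decay.

Lemma expr_lt_near (R : realType) (t e : R) : 0 <= t < 1 -> 0 < e ->
  exists N, forall n, (N <= n)%N -> t ^+ n < e.
Proof.
move=> /andP[t0 t1] e0; have /cvgrPdist_lt/(_ e e0)[N _ NP] : t ^+ n @[n --> \oo] --> 0.
  by apply: cvg_expr; rewrite ger0_norm.
exists N => n /NP /=; rewrite sub0r normrN ger0_norm // exprn_ge0 //.
Qed.

Lemma esum_le_seq (R : realType) (T : choiceType) (D : set T) (f : T -> R) c :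
  (forall W : seq T, uniq W -> (forall w, w \in W -> D w) -> \sum_(w <- W) f w <= c) ->
  (\esum_(w in D) (f w)%:E <= c%:E)%E.
Proof.
move=> h; apply: ge_ereal_sup => _ [X [finX XD] <-].
rewrite fsbig_finite // sumEFin lee_fin; apply: h; first exact: finmap.fset_uniq.
by move=> w; rewrite in_fset_set // inE => /XD.
Qed.

Lemma esum_ge_seq (R : realType) (T : choiceType) (D : set T) (f : T -> R) (W : seq T) :
  uniq W -> (forall w, w \in W -> D w) ->
  ((\sum_(w <- W) f w)%:E <= \esum_(w in D) (f w)%:E)%E.
Proof.
move=> uW WD; apply: esum_ge; exists [set` W]; first by split=> //; exact: finite_seq.
by rewrite -fsbig_seq // sumEFin.
Qed.

(** * The Green function as a sum over words *)

Section Green.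
Variables (R : realType) (G : groupType) (mu : G -> R) (S : seq G).
Hypotheses (S_uniq : uniq S) (mu_gt0 : forall s, s \in S -> 0 < mu s)
  (muV : forall s, mu s = mu (s^-1)%g) (SV : forall s, s \in S -> (s^-1)%g \in S)
  (mu_sum : \sum_(s <- S) mu s = 1) (S_gen : generates [set` S])
  (suppS : supp mu = [set` S]).

Local Notation ret := (return_prob mu S).
Local Notation hit := (hit mu S).

Fixpoint words n : seq (seq G) :=
  if n is n'.+1 then [seq s :: w | s <- S, w <- words n'] else [:: [::]].

Lemma words_uniq n : uniq (words n).
Proof.
elim: n => [//|n IHn] /=; apply: allpairs_uniq => //.
by move=> [s w] [s' w'] _ _ /= [-> ->].
Qed.

Lemma mem_words n w : (w \in words n) = (size w == n) && all (mem S) w.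
Proof.
elim: n w => [|n IHn] [|s w] //=.
  by apply/allpairsP => -[[t u] [_ _]].
rewrite eqSS andbCA -IHn; apply/allpairsP/andP => [[[t u] [/= tS uW [-> ->]]]|[sS wW]] //.
by exists (s, w).
Qed.

Lemma hit_words n v : hit n v = \sum_(w <- words n | (v * word_eval w)%g == 1%g) weight mu w.
Proof.
elim: n v => [|n IHn] v.
  by rewrite /= big_cons big_nil word_eval_nil mulg1 /weight big_nil addr0 /hit /=; case: eqP.
rewrite hitS [RHS]big_mkcond /= big_allpairs_dep; apply: eq_bigr => s _.
rewrite IHn [X in _ * X]big_mkcond mulr_sumr; apply: eq_bigr => w _.
rewrite word_eval_cons mulgA /weight big_cons; case: ifP => // _; by rewrite mulr0.
Qed.

Hypothesis mu_nneg : forall g, 0 <= mu g.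

Lemma weight_ge0 w : 0 <= weight mu w.
Proof. by apply: prodr_ge0 => s _. Qed.

(** Words to [g] lead from [g^-1] to the neutral element, and [hit n] collects the weights of those
    of length [n]. *)
Lemma sum_weight_le (W : seq (seq G)) g a k : uniq W ->
  (forall w, w \in W -> [/\ words_to (supp mu) g w, (a <= size w)%N & (size w < a + k)%N]) ->
  \sum_(w <- W) weight mu w <= \sum_(n < k) hit (a + n) (g^-1)%g.
Proof.
move=> uW WP.
pose L := flatten [seq [seq w <- words (a + n) | (g^-1 * word_eval w)%g == 1%g] | n <- iota 0 k].
have -> : \sum_(n < k) hit (a + n) (g^-1)%g = \sum_(w <- L) weight mu w.
  have e : iota 0 k = index_iota 0 k by rewrite /index_iota subn0.
  rewrite /L e big_flatten big_map big_mkord.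
  by apply: eq_bigr => n _; rewrite hit_words big_filter.
apply: ler_sum_subset => //; first exact: weight_ge0.
move=> w /WP[[Sw ew] lea ltk]; apply/flatten_mapP; exists (size w - a)%N.
  by rewrite mem_iota; lia.
rewrite mem_filter ew mulVg eqxx subnKC //= mem_words eqxx /=.
by apply/allP => s /Sw; rewrite suppS.
Qed.

Lemma words_to_hit g N : exists W, [/\ uniq W,
  forall w, w \in W -> words_to (supp mu) g w /\ (size w < N)%N
  & \sum_(w <- W) weight mu w = \sum_(n < N) hit n (g^-1)%g].
Proof.
elim: N => [|N [W [uW WP WE]]]; first by exists [::]; rewrite big_nil big_ord0.
exists (W ++ [seq w <- words N | (g^-1 * word_eval w)%g == 1%g]); split.
- rewrite cat_uniq uW filter_uniq ?words_uniq // andbT; apply/hasPn => w.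
  rewrite mem_filter mem_words => /and3P[_ /eqP sw _]; apply/negP => /= /WP[_].
  by rewrite sw ltnn.
- move=> w; rewrite mem_cat => /orP[/WP[? lt]|]; first by split=> //; apply: ltnW.
  rewrite mem_filter mem_words => /and3P[/eqP ew /eqP -> Sw]; split=> //; split.
    by move=> s /(allP Sw); rewrite suppS.
  by rewrite -[LHS](mulVKg g) ew mulg1.
- by rewrite big_cat big_ord_recr /= WE big_filter hit_words.
Qed.

Lemma weight_gt0 w : is_word [set` S] w -> 0 < weight mu w.
Proof. by move=> Sw; rewrite /weight big_seq; apply: prodr_gt0 => s /Sw/mu_gt0. Qed.

(** A word [w] to [g] followed by a loop leads again to [g], so [weight mu w] times a partial sum of
    return probabilities is at most the Green function at [g]. *)
Lemma transient_ret : transient mu -> exists Gam, forall N, \sum_(n < N) ret n <= Gam.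
Proof.
move=> [g gfin]; have [w [Sw ew]] := words_to_ex (A := [set` S]) SV S_gen g.
have w_gt0 := weight_gt0 Sw.
have g_ge0 : (0 <= green mu g)%E.
  by apply: esum_ge0 => v _; rewrite lee_fin weight_ge0.
have gE : green mu g = (fine (green mu g))%:E by rewrite fineK // ge0_fin_numE.
exists ((weight mu w)^-1 * fine (green mu g)) => N; rewrite ler_pdivlMl // mulr_sumr.
apply: (@le_trans _ _ (\sum_(n < size w + N) hit n (g^-1)%g)).
  rewrite big_split_ord /= -[leLHS]add0r; apply: lerD.
    by apply: sumr_ge0 => n _; apply: hit_ge0.
  apply: ler_sum => n _; have := weight_hit S_uniq mu_gt0 n (g^-1)%g Sw.
  by rewrite ew mulVg.
have [W [uW WP <-]] := words_to_hit g (size w + N).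
rewrite -lee_fin -gE; apply: esum_ge_seq => // u /WP[]//.
Qed.

(** By [hit_le], [hit] is at most [ret (2 m)] at time [2 m], and at most the mean of [ret (2 m)] and
    [ret (2 m + 2)] at time [2 m + 1]. The extra term in [even] pays for [ret (2 m + 2)]. *)
Lemma hit_sum_le Gam v : (forall N, \sum_(n < N) ret n <= Gam) ->
  forall N, \sum_(n < N) hit n v <= 4 * Gam.
Proof.
move=> retP.
have retG n : ret n <= Gam.
  apply: le_trans (retP n.+1); rewrite big_ord_recr /= lerDr.
  by apply: sumr_ge0 => k _; apply: hit_ge0.
have even m : \sum_(n < m + m) hit n v <= 3 * \sum_(n < m + m) ret n + ret (m + m).
  elim: m => [|m IHm].
    by rewrite !big_ord0 mulr0 add0r; apply: hit_ge0.
  rewrite addSn !addnS !big_ord_recr /=.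
  have h1 := hit_le S_uniq muV SV m m v; have h2 := hit_le S_uniq muV SV m m.+1 v.
  rewrite addSn !addnS in h2.
  have h5 : 0 <= ret (m + m) by apply: hit_ge0.
  have h3 : 0 <= ret (m + m).+1 by apply: hit_ge0.
  have h4 : 0 <= ret (m + m).+2 by apply: hit_ge0.
  rewrite -[markov mu S (hit (m + m)) v]/(hit (m + m).+1 v); lra.
move=> N; apply: (@le_trans _ _ (\sum_(n < N + N) hit n v)).
  by rewrite big_split_ord /= lerDl; apply: sumr_ge0 => n _; apply: hit_ge0.
by have := even N; have := retP (N + N)%N; have := retG (N + N)%N; lra.
Qed.

Lemma green_le Gam g : (forall N, \sum_(n < N) ret n <= Gam) ->
  (green mu g <= (4 * Gam)%:E)%E.
Proof.
move=> retP; apply: esum_le_seq => W uW WP.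
have szP w : w \in W -> (size w < 0 + (\max_(u <- W) size u).+1)%N.
  by move=> wW; rewrite add0n ltnS; apply: leq_bigmax_seq.
apply: le_trans (sum_weight_le (a := 0) uW _) _ => [w wW|].
  by split; [exact: WP|by []|exact: szP].
exact: hit_sum_le retP _.
Qed.

Lemma green_ge g w : words_to (supp mu) g w -> ((weight mu w)%:E <= green mu g)%E.
Proof.
move=> wg; have := @esum_ge_seq R _ (words_to (supp mu) g) (weight mu) [:: w] isT.
by rewrite big_seq1; apply=> u; rewrite inE => /eqP ->.
Qed.

(** The new rate satisfies [rho <= sg ^+ 2], and since [sg >= 1 / 2] an odd step costs at most a
    factor 2. *)
Lemma ret_geometric rho : 0 <= rho < 1 ->
  (forall n, ret (n + n) + ret (n + n).+1 <= 2 * rho ^+ n) ->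
  exists2 sigma, 0 < sigma < 1 & forall n, ret n <= 4 * sigma ^+ n.
Proof.
move=> /andP[r0 r1] retP; pose sg := (1 + rho) / 2.
have sg0 : 0 < sg by rewrite /sg; lra.
have sg1 : sg < 1 by rewrite /sg; lra.
exists sg; first by rewrite sg0.
have le n : rho ^+ n <= sg ^+ (n + n).
  rewrite addnn -mul2n exprM; apply: lerXn2r; rewrite ?nnegrE ?sqr_ge0 //.
  by have := sqr_ge0 (1 - rho); rewrite /sg !expr2; lra.
move=> n; have ret0 k : 0 <= ret k by apply: hit_ge0.
have nE : n = (odd n + (n./2 + n./2))%N by rewrite addnn odd_double_half.
move: nE; move: (odd n) (n./2) => b m ->.
have := retP m; have := le m; have := ret0 (m + m)%N; have := ret0 (m + m).+1.
have : 0 < sg ^+ (m + m) by rewrite exprn_gt0.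
case: b; rewrite ?add0n ?add1n; last by lra.
rewrite exprS; have : 2^-1 <= sg by rewrite /sg; lra.
set x := sg ^+ _; nra.
Qed.

Lemma geometric_tail (s : R) m k : 0 < s < 1 ->
  \sum_(n < k) s ^+ (m + n) <= s ^+ m / (1 - s).
Proof.
move=> /andP[s0 s1]; have s1' : 0 < 1 - s by rewrite subr_gt0.
rewrite ler_pdivlMr //.
have -> : (\sum_(n < k) s ^+ (m + n)) * (1 - s) = s ^+ m - s ^+ (m + k).
  elim: k => [|k IHk]; first by rewrite big_ord0 mul0r addn0 subrr.
  by rewrite big_ord_recr /= mulrDl IHk addnS exprS; ring.
by rewrite gerBl exprn_ge0 // ltW.
Qed.

End Green.

(** * The characterization of hyperbolicity *)

Lemma gromov_hyperbolicP (T : Type) (d : T -> T -> nat) :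
  gromov_hyperbolic d <-> exists D, hyp4 d D.
Proof.
split=> [[delta dH]|[D dH]].
  exists (Num.bound `|2 * delta|) => o x y z.
  set B := Num.bound _; have hB : 2 * delta <= B%:R.
    exact: le_trans (ler_norm _) (ltW (archi_boundP (normr_ge0 _))).
  have castle a b : (a%:R <= b%:R :> rat) -> (a <= b)%N by rewrite ler_nat.
  have := dH o x y z; case: (leP (gromov_product d o x y)) => _;
    rewrite /gromov_product => h1.
    have : (d x z + d o y <= d o z + d x y + B)%N by apply: castle; rewrite !natrD; lra.
    by lia.
  have : (d x z + d o y <= d o x + d y z + B)%N by apply: castle; rewrite !natrD; lra.
  by lia.
exists (D%:R / 2) => o x y z; rewrite /gromov_product.
set a := (X in Num.min X _); set b := (X in Num.min _ X).
have ha : Num.min a b <= a by rewrite ge_min lexx.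
have hb : Num.min a b <= b by rewrite ge_min lexx orbT.
have := dH o x y z; rewrite maxnE => h.
have [h'|h'] : (d x z + d o y <= d o z + d x y + D)%N \/ (d x z + d o y <= d o x + d y z + D)%N.
- lia.
- move: h' ha hb; rewrite -(ler_nat rat) !natrD /a /b; lra.
- move: h' ha hb; rewrite -(ler_nat rat) !natrD /a /b; lra.
Qed.

(** * Bridge probabilities and the two implications *)

Section Theorem2.
Variables (R : realType) (G : groupType) (mu : G -> R) (S : seq G).
Hypotheses (S_uniq : uniq S) (mu_gt0 : forall s, s \in S -> 0 < mu s)
  (muV : forall s, mu s = mu (s^-1)%g) (SV : forall s, s \in S -> (s^-1)%g \in S)
  (mu_sum : \sum_(s <- S) mu s = 1) (S_gen : generates [set` S])
  (suppS : supp mu = [set` S]) (mu_nneg : forall g, 0 <= mu g).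
Variables (e0 : R).
Hypotheses (e0_gt0 : 0 < e0) (e0_le1 : e0 <= 1) (e0P : forall s, s \in S -> e0 <= mu s).

Local Notation ret := (return_prob mu S).
Local Notation hit := (hit mu S).
Local Notation ds := (word_dist [set` S]).

Lemma weight_ge w : is_word [set` S] w -> e0 ^+ size w <= weight mu w.
Proof.
elim: w => [|s w IHw] Sw; first by rewrite expr0 /weight big_nil.
have [sS Sw'] := is_word_cons_inv Sw; rewrite exprS /weight big_cons.
apply: ler_pM => //; [exact: ltW|by rewrite exprn_ge0 // ltW|exact: e0P|exact: IHw].
Qed.

Section Transient.
Variable Gam : R.
Hypothesis retP : forall N, \sum_(n < N) ret n <= Gam.

Lemma green_fin g : green mu g = (fine (green mu g))%:E /\
  (forall w, words_to (supp mu) g w -> weight mu w <= fine (green mu g)) /\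
  fine (green mu g) <= 4 * Gam.
Proof.
have gle := green_le S_uniq mu_gt0 muV SV suppS mu_nneg g retP.
have g_ge0 : (0 <= green mu g)%E.
  by apply: esum_ge0 => v _; rewrite lee_fin weight_ge0.
have gE : green mu g = (fine (green mu g))%:E.
  by rewrite fineK // ge0_fin_numE // (le_lt_trans gle) // ltry.
split=> //; split; last by rewrite -lee_fin -gE.
by move=> w wg; rewrite -lee_fin -gE; apply: green_ge.
Qed.

(** A single detour [psi] has weight at least [e0 ^+ n], and by hypothesis at most [eps ^+ (10 * r)]
    times the bounded Green function. As [eps < e0], its length must exceed [10 * r] by a definite
    proportion. *)
Lemma decay_detour eps L0 : 0 < eps -> eps < e0 ->
  (forall gamma : seq G, geodesic (supp mu) gamma -> (L0 <= size gamma)%N ->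
    (bridge_prob mu (word_eval gamma) (path_avoids (ball_vertices R (supp mu) gamma))
      <= (eps ^+ (5 * size gamma))%:E)%E) ->
  exists q r0, (0 < q)%N /\ detour ds q r0.
Proof.
move=> eps0 epse bnd.
(* [q] is taken with [(eps / e0) ^ (10 q) < e0]: the factor [e0] pays for the additional [r / q] in
   the length, and [t ^ r] eventually beats the constant [B ^ q]. *)
pose t0 := (eps / e0) ^+ 10.
have t00 : 0 < t0 by rewrite exprn_gt0 // divr_gt0.
have t01 : t0 < 1 by rewrite expr_lt1 // ?divr_ge0 ?ltW // ltr_pdivrMr // mul1r.
have [q0 q0P] := @expr_lt_near R t0 e0 ltac:(by rewrite (ltW t00) t01) e0_gt0.
pose q := q0.+1; have qP : t0 ^+ q < e0 by apply: q0P; rewrite leqnSn.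
pose t := t0 ^+ q / e0.
have t_ge0 : 0 <= t by apply: divr_ge0; [exact/exprn_ge0/ltW|exact: ltW].
have t_lt1 : t < 1 by rewrite /t ltr_pdivrMr // mul1r.
pose B := 1 + 4 * `|Gam|.
have B_gt0 : 0 < B by rewrite /B; have := normr_ge0 Gam; lra.
have [r1 r1P] := @expr_lt_near R t ((B ^+ q)^-1) ltac:(by rewrite t_ge0 t_lt1)
  ltac:(by rewrite invr_gt0 exprn_gt0).
exists q, (maxn L0 r1); split=> // r c n; rewrite geq_max => /andP[leL ler1] gc cn.
have Ssym : symmetric_set [set` S] by move=> s; apply: SV.
have [w [gw sw cw]] := geod_geodesic Ssym S_gen gc.
have [psi [Spsi spsi epsi Ppsi]] := conn_word Ssym S_gen cn.
have c2r : c (2 * r)%N = (c 0 * word_eval w)%g by rewrite (cw (2 * r)%N) // -sw take_size.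
have ev : word_eval psi = word_eval w.
  by apply: (@mulgI _ (c 0%N)); rewrite epsi c2r.
have avoid : path_avoids (ball_vertices R (supp mu) w) psi.
  move=> i lei; rewrite /ball_vertices /= suppS => /lt_geF/negP; apply.
  have rl : (r <= 2 * r)%N by rewrite leq_pmull.
  have := Ppsi i lei; rewrite [X in word_dist _ X _](cw r rl) word_distM.
  have odd0 : odd (size w) = false by rewrite sw mul2n odd_double.
  have half : (size w)./2 = r by rewrite sw mul2n doubleK.
  (* The length is even, so the midpoint is the vertex [m]; the other term of the minimum is no
     smaller, as [m'] is at most one step from [m]. *)
  rewrite /dist_to_midpoint /dist_to_edge_point odd0 half mul0r addr0 subr0.
  have -> : (size w)%:R / 2 = r%:R :> R by rewrite sw natrM mulrC mulKf // pnatr_eq0.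
  have dM := word_dist_metric Ssym S_gen; case: (dM) => d0 dC dT.
  set v := word_eval (take i psi); set m := word_eval (take r w).
  set m' := word_eval (take r.+1 w) => le.
  have le1 : (ds m m' <= 1)%N.
    have [Sw _] := gw; have := word_dist_take Ssym S_gen 1%g Sw (leqnSn r).
    rewrite !mul1g => h; case: (ltnP r (size w)) => [/h|le2]; first by rewrite subSnn.
    by rewrite /m /m' !take_oversize ?(leqW le2) // d0.
  rewrite le_min dC ler_nat le /=.
  rewrite natr1 ler_nat (leq_trans le) // (leq_trans (dT m m' v)) //.
  by rewrite (dC v m') -add1n leq_add2r.
have wpsi : words_to (supp mu) (word_eval w) psi by split; [rewrite suppS|].
have [gE [gW gB]] := green_fin (word_eval w).
have Wpsi : weight mu psi <= B * eps ^+ (10 * r).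
  have := bnd w; rewrite suppS => /(_ gw) h; have {}h := h _; rewrite -suppS in h.
  have {}h := h ltac:(by rewrite sw (leq_trans leL) // leq_pmull).
  have h' := fun P => le_trans (@esum_ge_seq R _ _
    (fun u => weight mu u / fine (green mu (word_eval w))) [:: psi] isT P) h.
  rewrite big_seq1 lee_fin sw mulnA in h'.
  have Wp_gt0 : 0 < weight mu psi := weight_gt0 mu_gt0 Spsi.
  have gpos : 0 < fine (green mu (word_eval w)) := lt_le_trans Wp_gt0 (gW _ wpsi).
  have : weight mu psi / fine (green mu (word_eval w)) <= eps ^+ (10 * r).
    by apply: h' => u; rewrite inE => /eqP ->.
  rewrite ler_pdivrMr // mulrC => h2; apply: (le_trans h2).
  apply: ler_wpM2r; first by rewrite exprn_ge0 // ltW.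
  by apply: (le_trans gB); rewrite /B; have := ler_norm Gam; lra.
have {Wpsi}bound : e0 ^+ n <= B * eps ^+ (10 * r).
  apply: le_trans Wpsi; apply: le_trans (weight_ge Spsi).
  by apply: ler_wiXn2l => //; apply: ltW.
rewrite leqNgt; apply/negP => ltq.
have e0n : e0 ^+ ((10 * q + 1) * r) <= (e0 ^+ n) ^+ q.
  by rewrite -exprM; apply: ler_wiXn2l; rewrite ?(ltW e0_gt0) // mulnC ltnW.
have nn1 : e0 ^+ n \is Num.nneg by rewrite nnegrE exprn_ge0 // ltW.
have nn2 : B * eps ^+ (10 * r) \is Num.nneg.
  by rewrite nnegrE; apply: mulr_ge0; [exact: ltW|exact/exprn_ge0/ltW].
have := le_trans e0n (lerXn2r q nn1 nn2 bound).
have tE : (eps ^+ (10 * r)) ^+ q = t ^+ r * e0 ^+ ((10 * q + 1) * r).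
  have -> : t = eps ^+ (10 * q) / e0 ^+ (10 * q + 1).
    by rewrite /t /t0 -exprM expr_div_n addn1 exprSr invfM mulrA.
  by rewrite expr_div_n -!exprM mulfVK ?expf_neq0 ?gt_eqF // mulnAC.
rewrite exprMn tE mulrA -[leLHS]mul1r ler_pM2r ?exprn_gt0 // => le1.
have := r1P r ler1; rewrite -[ltRHS]mul1r ltr_pdivlMr ?exprn_gt0 // mulrC.
by rewrite ltNge le1.
Qed.

End Transient.

(** One factor [e0 ^ l] comes from completing paths to loops by a word of length [l], the other from
    the Green function being at least the weight of [gamma]; the rest is a geometric tail. *)
Lemma bridge_prob_le sigma gamma E m : 0 < sigma < 1 ->
  (forall n, ret n <= 4 * sigma ^+ n) -> geodesic [set` S] gamma ->
  (forall psi, words_to (supp mu) (word_eval gamma) psi -> E psi -> (m <= size psi)%N) ->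
  (bridge_prob mu (word_eval gamma) E <=
    (4 * (sigma ^+ m / (1 - sigma)) / e0 ^+ (2 * size gamma))%:E)%E.
Proof.
move=> sg retP [Sg _] longE; have [s0 s1] := andP sg.
have sum_ret N : \sum_(n < N) ret n <= 4 * (sigma ^+ 0 / (1 - sigma)).
  apply: (@le_trans _ _ (\sum_(n < N) 4 * sigma ^+ (0 + n))); first exact: ler_sum.
  by rewrite -mulr_sumr ler_wpM2l // geometric_tail.
have [_ [gW _]] := green_fin sum_ret (word_eval gamma).
set l := size gamma.
have el_gt0 : 0 < e0 ^+ l by rewrite exprn_gt0.
have gr_ge : e0 ^+ l <= fine (green mu (word_eval gamma)).
  by apply: le_trans (weight_ge Sg) (gW _ _); split; rewrite ?suppS.
have gr_gt0 := lt_le_trans el_gt0 gr_ge.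
apply: esum_le_seq => W uW WE; rewrite -mulr_suml.
set k := (\max_(u <- W) size u).+1.
have W_le : \sum_(w <- W) weight mu w <= \sum_(n < k) hit (m + n) ((word_eval gamma)^-1)%g.
  apply: (sum_weight_le S_uniq suppS mu_nneg uW) => w wW; have [ww Ew] := WE w wW.
  split=> //; first exact: longE.
  by rewrite ltn_addl // ltnS; apply: leq_bigmax_seq.
have hit_le' n : e0 ^+ l * hit (m + n) ((word_eval gamma)^-1)%g <= 4 * sigma ^+ (m + n).
  rewrite -word_eval_inv /l -size_inv_word.
  have Sg' : is_word [set` S] (inv_word gamma) by apply: is_word_inv.
  apply: le_trans (hit_le_ret S_uniq mu_gt0 (m + n) (ltW e0_gt0) e0P Sg') _.
  apply: le_trans (retP _) _; apply: ler_wpM2l => //.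
  by apply: ler_wiXn2l; rewrite ?leq_addl // ltW.
have tail : e0 ^+ l * \sum_(w <- W) weight mu w <= 4 * (sigma ^+ m / (1 - sigma)).
  apply: (@le_trans _ _ (\sum_(n < k) 4 * sigma ^+ (m + n))).
    apply: le_trans (ler_wpM2l (ltW el_gt0) W_le) _; rewrite mulr_sumr; exact: ler_sum.
  by rewrite -mulr_sumr ler_wpM2l // geometric_tail.
have W_ge0 : 0 <= \sum_(w <- W) weight mu w.
  by apply: sumr_ge0 => w _; apply: weight_ge0.
rewrite ler_pdivlMr ?exprn_gt0 //; apply: le_trans tail.
rewrite mulrAC ler_pdivrMr // mulnC exprM expr2 [leLHS]mulrC -mulrA [leRHS]mulrAC.
rewrite -!mulrA ler_wpM2l ?(ltW el_gt0) // mulrC [leRHS]mulrC.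
by rewrite ler_wpM2l.
Qed.

(** For odd length the midpoint is at distance 1/2 from the vertex [gam (size gamma)./2], whence the
    [+ 1]. *)
Lemma avoiding_conn gamma psi : geodesic [set` S] gamma -> is_word [set` S] psi ->
  word_eval psi = word_eval gamma -> path_avoids (ball_vertices R (supp mu) gamma) psi ->
  let gam i := (1 * word_eval (take i gamma))%g in
  conn (adj ds) (fun v => (size gamma <= 2 * ds (gam (size gamma)./2) v + 1)%N)
    (size psi) (gam 0%N) (gam (size gamma)).
Proof.
move=> [Sg _] Spsi ev avoid gam; have Ssym : symmetric_set [set` S] by move=> s; apply: SV.
have -> : gam 0%N = 1%g by rewrite /gam take0 word_eval_nil mulg1.
have -> : gam (size gamma) = (1 * word_eval psi)%g by rewrite /gam take_size ev.
apply: (word_conn Ssym S_gen Spsi) => i lei.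
rewrite /gam !mul1g leqNgt; apply/negP => lt; apply: (avoid i lei).
rewrite /ball_vertices /= suppS /dist_to_midpoint /dist_to_edge_point.
rewrite gt_min; apply/orP; left.
have [_ dC _] := word_dist_metric Ssym S_gen; rewrite dC.
move: lt; move: (ds _ _) => x; move: (size gamma) => l lt.
have lt' : (2 * x + odd l < l)%N by move: lt; clear; lia.
move: lt'; rewrite -(ltr_nat R) natrD natrM; lra.
Qed.

(** Hyperbolicity is given for some generating set [A], geodesics are taken in the support; the two
    word metrics are Lipschitz equivalent, which is all that [avoiding_path_superlinear] needs. *)
Lemma hyperbolic_decay Gam : (forall N, \sum_(n < N) ret n <= Gam) -> hyperbolic_group G ->
  exists L0 : nat, forall gamma : seq G, geodesic (supp mu) gamma -> (L0 <= size gamma)%N ->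
    (bridge_prob mu (word_eval gamma) (path_avoids (ball_vertices R (supp mu) gamma))
      <= ((e0 / 2) ^+ (5 * size gamma))%:E)%E.
Proof.
move=> retP [A [Afin Asym Agen /gromov_hyperbolicP[D dH]]].
have Ssym : symmetric_set [set` S] by move=> s; apply: SV.
have unb := recurrent_spheres S_uniq mu_gt0 muV SV mu_sum Asym Agen Afin retP.
have [M [r [chl [M_gt0 chl_size chl_near parents]]]] := branching Asym Agen Afin dH unb.
have [B BP] := branching_energy R Asym Agen Afin M_gt0 (fun v => (chl_size v).1)
  (fun v => (chl_size v).2) chl_near parents.
have [rho rho01 rhoP] := ret_decay S_uniq mu_gt0 muV SV mu_sum S_gen BP.
have [sg sg01 sgP] := ret_geometric mu_gt0 rho01 rhoP.
have [sg0 sg1] := andP sg01.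
have [c1 c1P] := word_length_lipschitz Asym Agen (finite_seq S).
have [c2 c2P] := word_length_lipschitz Ssym S_gen Afin.
pose c := maxn c1 c2.
have leAS x y : (word_dist A x y <= c * ds x y)%N.
  have [[w [Sw ew] sw] _] := word_lengthP Ssym S_gen (x^-1 * y)%g.
  rewrite /word_dist -sw -ew; apply: leq_trans (c1P w Sw) _.
  by rewrite leq_mul2r leq_maxl orbT.
have leSA x y : (ds x y <= c * word_dist A x y)%N.
  have [[w [Sw ew] sw] _] := word_lengthP Asym Agen (x^-1 * y)%g.
  rewrite /word_dist -sw -ew; apply: leq_trans (c2P w Sw) _.
  by rewrite leq_mul2r leq_maxr orbT.
have h_gt0 : 0 < e0 / 2 by rewrite divr_gt0.
(* The exponent is 5 + 2: five for the claimed bound and two against the denominator [e0 ^+ (2 * l)]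
   in [bridge_prob_le]. The remaining [4^-1 ^+ l] absorbs [4 / (1 - sg)]. *)
have [K KP] := @expr_lt_near R sg ((e0 / 2) ^+ 7) ltac:(by rewrite (ltW sg0) sg1)
  ltac:(by rewrite exprn_gt0).
have [L LP] := avoiding_path_superlinear (word_dist_metric Asym Agen)
  (word_dist_geodesic_space Asym Agen) dH leAS leSA K.
have s1' : 0 < 1 - sg by rewrite subr_gt0.
have [L1 L1P] := @expr_lt_near R (4^-1) ((1 - sg) / 4) ltac:(by apply/andP; split; lra)
  ltac:(by rewrite divr_gt0).
exists (maxn L L1) => gamma gg; rewrite geq_max => /andP[leL leL1].
rewrite suppS in gg; set l := size gamma in leL leL1 *.
have long psi : words_to (supp mu) (word_eval gamma) psi ->
    path_avoids (ball_vertices R (supp mu) gamma) psi -> (K * l <= size psi)%N.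
  move=> [Spsi ev] avoid; rewrite suppS in Spsi.
  apply: (LP l (fun i => 1 * word_eval (take i gamma))%g _ leL).
    exact: geodesic_geod.
  exact: avoiding_conn.
apply: (le_trans (bridge_prob_le sg01 sgP gg long)); rewrite lee_fin.
have sgK : sg ^+ (K * l) <= (e0 / 2) ^+ (5 * l) * (e0 / 2) ^+ (2 * l).
  rewrite -exprD -mulnDl exprM [leRHS]exprM; apply: lerXn2r; rewrite ?nnegrE ?exprn_ge0 ?ltW //.
  exact: KP.
have quarter : (e0 / 2) ^+ (2 * l) = e0 ^+ (2 * l) * (4^-1) ^+ l.
  by rewrite !exprM -exprMn; congr (_ ^+ l); rewrite !expr2; field.
rewrite ler_pdivrMr ?exprn_gt0 // [leLHS]mulrA ler_pdivrMr //.
apply: (@le_trans _ _ (4 * ((e0 / 2) ^+ (5 * l) * (e0 / 2) ^+ (2 * l)))).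
  by rewrite ler_wpM2l.
rewrite quarter mulrCA -!mulrA ler_wpM2l ?exprn_ge0 ?(ltW h_gt0) // mulrCA.
rewrite ler_wpM2l ?exprn_ge0 ?(ltW e0_gt0) //.
by have := L1P l leL1; rewrite ltr_pdivlMr // mulrC => /ltW.
Qed.

End Theorem2.

Theorem theorem2 (R : realType) (G : groupType) (mu : G -> R)
    (mu_admissible : admissible mu) (mu_transient : transient mu) :
  hyperbolic_group G <->
  exists eps : R, [/\ 0 < eps, eps < min_weight mu
    & exists L0 : nat, forall gamma : seq G,
        geodesic (supp mu) gamma -> (L0 <= size gamma)%N ->
        (bridge_prob mu (word_eval gamma)
           (path_avoids (ball_vertices R (supp mu) gamma))
         <= (eps ^+ (5 * size gamma))%:E)%E].
Proof.
have [mu0 muV finS gen sum1] := mu_admissible.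
have [S0 S0E] := (finite_seqP _).1 finS.
pose S := undup S0; have S_uniq : uniq S := undup_uniq _.
have suppS : supp mu = [set` S].
  by rewrite S0E; apply/seteqP; split=> x /=; rewrite mem_undup.
have mem_S s : (s \in S) = (0 < mu s).
  apply/idP/idP => [sS|lt].
    by have : [set` S] s by []; rewrite -suppS.
  by have : supp mu s by []; rewrite suppS.
have mu_gt0 s : s \in S -> 0 < mu s by rewrite mem_S.
have SV s : s \in S -> (s^-1)%g \in S by rewrite !mem_S -muV.
have mu_sum : \sum_(s <- S) mu s = 1 by rewrite fsbig_seq // -suppS.
have S_gen : generates [set` S] by rewrite -suppS.
have [s0 s0S] : exists s, s \in S.
  case E : S => [|s S']; last by exists s; rewrite mem_head.
  by move/eqP: mu_sum; rewrite E big_nil eq_sym oner_eq0.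
set e0 := min_weight mu.
have lb : lbound [set mu s | s in supp mu] 0 by move=> _ [s _ <-]; apply: mu0.
have e0P s : s \in S -> e0 <= mu s.
  by move=> sS; apply: ge_inf; [exists 0|exists s => //; rewrite suppS].
(* The infimum is positive because the support is finite: a positive lower bound is built along
   [S]. *)
have e0_gt0 : 0 < e0.
  have [m m_gt0 mP] : exists2 m, 0 < m & forall s, s \in S -> m <= mu s.
    elim: (S) (mu_gt0) => [|s S' IH] pos; first by exists 1.
    have [|m m_gt0 mP] := IH; first by move=> t tS; apply: pos; rewrite inE tS orbT.
    exists (Num.min m (mu s)) => [|t]; first by rewrite lt_min m_gt0 pos // mem_head.
    by rewrite inE ge_min => /orP[/eqP ->|/mP ->]; rewrite ?lexx ?orbT.
  apply: (lt_le_trans m_gt0); apply: lb_le_inf; first by exists (mu s0), s0; rewrite // suppS.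
  by move=> _ [s sS <-]; apply: mP; rewrite suppS in sS.
have e0_le1 : e0 <= 1.
  apply: le_trans (e0P _ s0S) _; rewrite -mu_sum (bigD1_seq s0) //= lerDl.
  by apply: sumr_ge0 => s _.
have [Gam retP] := transient_ret S_uniq mu_gt0 SV S_gen suppS mu0 mu_transient.
split=> [hyp|[eps [eps0 epse [L0 bnd]]]].
  exists (e0 / 2); split; [by rewrite divr_gt0|by rewrite ltr_pdivrMr // ltr_pMr // ltr1n|].
  exact: hyperbolic_decay retP hyp.
exists (supp mu); split=> //.
  by move=> s /=; rewrite /supp /= -muV.
rewrite suppS; apply/gromov_hyperbolicP.
have Ssym : symmetric_set [set` S] by move=> s; apply: SV.
have [q [r0 [q_gt0 dD]]] := decay_detour S_uniq mu_gt0 muV SV S_gen suppS mu0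
  e0_gt0 e0_le1 e0P retP eps0 epse bnd.
by have := detour_hyperbolic (word_dist_metric Ssym S_gen) (word_dist_geodesic_space Ssym S_gen)
  q_gt0 dD.
Qed.
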